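(* There is a nice equilibrium triangulation of $\mathbb{R}P^4$ with $21$ vertices.
   Context: A combinatorial triangulation of a PL $d$-manifold is an abstract simplicial complex whose underlying space is the manifold and in which the link of every $m$-simplex is a PL $(d-m-1)$-sphere. For $\mathbb{R}P^k$ with homogeneous coordinates $[x_0,\dots,x_k]$, let $B_i=\{|x_i|\ge|x_j| \ \forall j\}$ and, for nonempty $I\subseteq\{0,\dots,k\}$, let $B_I=\bigcap_{i\in I}B_i$. An equilibrium triangulation of $\mathbb{R}P^k$ is a combinatorial triangulation in which all the $B_I$ are PL homeomorphic to subcomplexes, i.e. the triangulation realises each $B_I$ as a subcomplex. Let $C_k$ be the following polyhedral decomposition of $\mathbb{R}P^k$. Take the boundary of the $(k+1)$-cube $[-1,1]^{k+1}$ and identify antipodal points. This gives $2^k$ vertices and $k+1$ cubes of dimension $k$, one for each pair of opposite facets; the $i$-th such cube corresponds to $B_i$. For each of these $k$-cubes, cone its $2k$ facets, which are $(k-1)$-cubes, to a new vertex at the centre of that $k$-cube. The result $C_k$ has $2^k+k+1$ vertices and consists of $2k(k+1)$ pyramids over $(k-1)$-cubes. An equilibrium triangulation of $\mathbb{R}P^k$ is nice if it is a simplicial subdivision of $C_k$ without additional vertices. *)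

(* Defs.v *)
From HB Require Import structures.
From mathcomp Require Import all_boot all_order all_algebra.
From mathcomp Require Import all_classical all_reals all_analysis.

Set Implicit Arguments.
Unset Strict Implicit.
Unset Printing Implicit Defensive.

Import Order.TTheory GRing.Theory Num.Theory.
Import numFieldNormedType.Exports.

Local Open Scope classical_set_scope.
Local Open Scope ring_scope.
Local Open Scope quotient_scope.

Section Complexes.
Variable N : nat.
Implicit Types (K L : {set {set 'I_N}}) (s t : {set 'I_N}) (v : 'I_N).

(* The empty face belongs to every nonempty complex. *)
Definition simplicial_complex K :=
  forall s t, s \in K -> t \subset s -> t \in K.

Definition vertices K : {set 'I_N} := [set v | [set v]%SET \in K]%SET.

Definition link K s : {set {set 'I_N}} :=
  [set t in K | [disjoint t & s] && ((t :|: s)%SET \in K)]%SET.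

End Complexes.

Definition simplex_boundary (n : nat) : {set {set 'I_n}} :=
  [set s : {set 'I_n} | s != [set: 'I_n]%SET]%SET.

Section Realization.
Variables (R : realType) (N : nat).

(* Barycentric coordinates: the vertex v is the basis vector delta_mx 0 v. *)
Definition simplex_pts (s : {set 'I_N}) : set 'rV[R]_N :=
  [set x | [/\ forall v, 0 <= x 0 v,
               \sum_v x 0 v = 1 &
               forall v, v \notin s -> x 0 v = 0]].

Definition realization (K : {set {set 'I_N}}) : set 'rV[R]_N :=
  [set x | exists2 s, s \in K & simplex_pts s x].

End Realization.

Arguments realization R {N} K.

Definition homeomorphism (S T : topologicalType) (A : set S) (B : set T)
    (f : S -> T) :=
  {within A, continuous f} /\
  exists g : T -> S,
    [/\ {within B, continuous g},
        forall x, A x -> B (f x) /\ g (f x) = x &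
        forall y, B y -> A (g y) /\ f (g y) = y].

Section PL.
Variable R : realType.

Definition convex_polyhedron (n : nat) (P : set 'rV[R]_n) :=
  exists (p : nat) (A : 'M[R]_(n, p)) (b : 'rV[R]_p),
    P = [set x | forall j, (x *m A) 0 j <= b 0 j].

Definition finitely_piecewise (n : nat) (X : set 'rV[R]_n)
    (good : set 'rV[R]_n -> Prop) :=
  exists (q : nat) (P : 'I_q -> set 'rV[R]_n),
    [/\ forall i, convex_polyhedron (P i),
        forall x, X x -> exists i, P i x &
        forall i, good (X `&` P i)].

(* A map X -> R^m is PL when X is covered by finitely many convex polyhedra on
   each of which it is affine; the pieces being closed, it is continuous. *)
Definition pl_map (n m : nat) (X : set 'rV[R]_n) (f : 'rV[R]_n -> 'rV[R]_m) :=
  finitely_piecewise X (fun P =>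
    exists (M : 'M[R]_(n, m)) (c : 'rV[R]_m),
      forall x, P x -> f x = x *m M + c).

Definition pl_homeomorphic (n m : nat)
    (X : set 'rV[R]_n) (Y : set 'rV[R]_m) :=
  exists (f : 'rV[R]_n -> 'rV[R]_m) (g : 'rV[R]_m -> 'rV[R]_n),
    [/\ pl_map X f, pl_map Y g,
        forall x, X x -> Y (f x) /\ g (f x) = x &
        forall y, Y y -> X (g y) /\ f (g y) = y].

(* [pl_sphere n K] says that K is a PL sphere of dimension n - 1, i.e. PL
   homeomorphic to the boundary of an n-simplex; n = 0 is the (-1)-sphere, whose
   underlying space is empty. *)
Definition pl_sphere (N n : nat) (K : {set {set 'I_N}}) :=
  pl_homeomorphic (realization R K) (realization R (simplex_boundary n.+1)).

End PL.

Section ProjectiveSpace.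
Variables (R : realType) (k : nat).

Definition nzvec := set_type [set x : 'rV[R]_k.+1 | x != 0].
HB.instance Definition _ := Topological.on nzvec.

Definition proportional (x y : nzvec) : bool :=
  `[< exists2 a : R, a != 0 & set_val x = a *: set_val y >].

Lemma proportional_refl : reflexive proportional.
Proof. by move=> x; apply/asboolP; exists 1; rewrite ?oner_eq0 ?scale1r. Qed.

Lemma proportional_sym : symmetric proportional.
Proof.
have H x y : proportional x y -> proportional y x.
  move=> /asboolP[a a0 xE]; apply/asboolP; exists a^-1; rewrite ?invr_eq0//.
  by rewrite xE scalerA mulVf// scale1r.
by move=> x y; apply/idP/idP; exact: H.
Qed.

Lemma proportional_trans : transitive proportional.
Proof.
move=> y x z /asboolP[a a0 xE] /asboolP[b b0 yE]; apply/asboolP.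
by exists (a * b); rewrite ?mulf_neq0// xE yE scalerA.
Qed.

Definition proportional_equiv :=
  EquivRel proportional proportional_refl proportional_sym proportional_trans.

Definition RP : Type := {eq_quot proportional_equiv}.
HB.instance Definition _ := Topological.copy RP
  (quotient_topology {eq_quot proportional_equiv}).
HB.instance Definition _ := Quotient.on RP.

(* [hcoords p x] : x is a vector of homogeneous coordinates of p. *)
Definition hcoords (p : RP) (x : 'rV[R]_k.+1) :=
  exists2 y : nzvec, set_val y = x & p = \pi_RP y.

Definition B (i : 'I_k.+1) : set RP :=
  [set p | exists2 x, hcoords p x & forall j, `|x 0 j| <= `|x 0 i|].

Definition BI (I : {set 'I_k.+1}) : set RP :=
  [set p | forall i, i \in I -> B i p].

Definition cube_boundary : set 'rV[R]_k.+1 :=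
  [set x | (forall j, `|x 0 j| <= 1) /\ exists j, `|x 0 j| = 1].

(* RP^k carries the PL structure that makes the double cover of it by the
   boundary of [-1,1]^(k+1) PL. *)
Definition pl_map_RP (n : nat) (X : set 'rV[R]_n) (h : 'rV[R]_n -> RP) :=
  finitely_piecewise X (fun P =>
    exists (M : 'M[R]_(n, k.+1)) (c : 'rV[R]_k.+1),
      forall x, P x ->
        cube_boundary (x *m M + c) /\ hcoords (h x) (x *m M + c)).

(* Of each pair of antipodal k-cubes {x_i = 1}, {x_i = -1} in the boundary of
   [-1,1]^(k+1), the first one is taken as the lift of B_i; its centre is the
   basis vector e_i, and its facets are given by j != i and a sign. *)
Definition cube_facet (i j : 'I_k.+1) (e : bool) : set 'rV[R]_k.+1 :=
  [set x | [/\ x 0 i = 1, x 0 j = (-1) ^+ e & forall l, `|x 0 l| <= 1]].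

Definition pyramid (i j : 'I_k.+1) (e : bool) : set 'rV[R]_k.+1 :=
  [set x | exists (t : R) (y : 'rV[R]_k.+1),
     [/\ 0 <= t <= 1, cube_facet i j e y &
         x = (1 - t) *: delta_mx 0 i + t *: y]].

Definition C_vertices : set RP :=
  [set p | (exists2 x, hcoords p x & forall j, `|x 0 j| = 1) \/
           exists i, hcoords p (delta_mx 0 i)].

End ProjectiveSpace.

Section Triangulations.
Variables (R : realType) (k N : nat).
Variables (K : {set {set 'I_N}}) (h : 'rV[R]_N -> RP R k).

Definition combinatorial_triangulation :=
  [/\ simplicial_complex K,
      homeomorphism (realization R K) [set: RP R k] h,
      pl_map_RP (realization R K) h &
      forall (m : nat) s, s \in K -> #|s| = m.+1 ->
        (m <= k)%N /\ pl_sphere R (k - m) (link K s)].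

Definition equilibrium_triangulation :=
  combinatorial_triangulation /\
  forall I : {set 'I_k.+1}, I != finset.set0 ->
    exists L : {set {set 'I_N}},
      [/\ simplicial_complex L, L \subset K &
          h @` realization R L = BI I].

(* h being a homeomorphism onto RP^k, this says that each simplex is mapped
   affinely onto a straight simplex inside one of the pyramids of C_k. *)
Definition subdivides_C :=
  forall s, s \in K ->
    exists (i j : 'I_k.+1) (e : bool) (M : 'M[R]_(N, k.+1)),
      j != i /\
      forall x, simplex_pts s x ->
        pyramid i j e (x *m M) /\ hcoords (h x) (x *m M).

Definition nice_equilibrium_triangulation :=
  [/\ equilibrium_triangulation,
      subdivides_C &
      [set h (delta_mx 0 v) | v in [set` vertices K]] = @C_vertices R k].

End Triangulations.

(* Main.v *)
From Stdlib Require Import BinNat.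
Require Import Defs.
From mathcomp Require Import all_boot all_order all_algebra.
From mathcomp Require Import all_classical all_reals all_analysis.
From mathcomp Require Import lra.

(* The double cover of RP^4 is the boundary of [-1,1]^5. Among the antipodal
   triangulations of its 3-cubes without new vertices we take one in which no square
   diagonal xy occurs together with the space diagonal x(-y), so that the quotient by
   the antipodal map is a simplicial complex K. The cones over the lifted simplices
   form a complete simplicial fan in R^5. This is checked on finite data: the fan of the pyramids of C_4 is induced by
   heights, and so is its subdivision inside each pyramid, by heights that depend on
   the pyramid; given a point y, a cone whose pair of linear forms is lexicographically
   maximal at y contains y, since otherwise crossing a wall would increase the pair.

   The map to RP^4 is linear on each lifted simplex, and the fan property makes it a
   bijection. The link of a simplex s is again a complete fan, in the quotient of R^5 by
   the span of s. Finally the complex underlying a complete fan in R^n is a PL sphere: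
   starring edges at their intersections with the hyperplanes y_i = y_j (0 <= i < j <= n,
   y_0 = 0) does not change the polyhedron, and once no edge crosses these hyperplanes
   the fan refines that of a simplex and maps simplexwise linearly onto its boundary. *)

Set Implicit Arguments.
Unset Strict Implicit.
Unset Printing Implicit Defensive.

Import Order.TTheory GRing.Theory Num.Theory.
Import numFieldNormedType.Exports.

Local Open Scope ring_scope.

(** Radial projection is not piecewise linear, so a complete fan cannot be compared directly with
    the boundary of a simplex. After the starring, the representative modulo (1, ..., 1) with
    minimum 0 depends linearly on the point of each cone, and rescaling is needed at the vertices
    only.

    If x and y differ in d of the five coordinates, x and -y differ in 5 - d. Both pairs can lie in
    3-cubes only for d = 2 or 3, so a square diagonal against a space diagonal is the only possible
    conflict between cube vertices in the antipodal quotient.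

    The coarse heights come from a convex function: twice the largest plus the second largest
    absolute value of the coordinates. It is linear on the cone over each pyramid. The second
    heights are compared only between cones of one pyramid, so across pyramids only faces have to
    match. *)

(** * Piecewise linear maps and their composition *)

Section PiecewiseLinear.
Variable R : realType.

Lemma convex_polyhedron_fin (n : nat) (I : finType) (a : I -> 'cV[R]_n)
    (b : I -> R) :
  convex_polyhedron [set x : 'rV[R]_n | forall i, (x *m a i) 0 0 <= b i]%classic.
Proof.
exists #|I|, (\matrix_(r < n, j < #|I|) a (enum_val j) r 0), (\row_j b (enum_val j)).
have E (x : 'rV[R]_n) i :
    (x *m (\matrix_(r < n, j < #|I|) a (enum_val j) r 0)) 0 (enum_rank i) =
    (x *m a i) 0 0.
  by rewrite !mxE; apply: eq_bigr => r _; rewrite !mxE enum_rankK.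
apply/seteqP; split => x /= xP.
- move=> j; rewrite -(enum_valK j) E [X in _ <= X]mxE enum_rankK; exact: xP.
- by move=> i; have := xP (enum_rank i); rewrite E [X in _ <= X]mxE enum_rankK.
Qed.

Lemma convex_polyhedronT (n : nat) : convex_polyhedron [set: 'rV[R]_n]%classic.
Proof. by exists 0, 0, 0; apply/seteqP; split => // x _ []. Qed.

Lemma convex_polyhedronI (n : nat) (P Q : set 'rV[R]_n) :
  convex_polyhedron P -> convex_polyhedron Q -> convex_polyhedron (P `&` Q)%classic.
Proof.
move=> [p [A [b ->]]] [q [C [d ->]]].
exists (p + q)%N, (row_mx A C), (row_mx b d); apply/seteqP; split => x /=.
- move=> [xA xC] j; rewrite mul_mx_row -(fintype.splitK j).
  by case: (fintype.split j) => k /=; rewrite ?row_mxEl ?row_mxEr.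
- move=> H; split => j.
  + by have := H (lshift q j); rewrite mul_mx_row !row_mxEl.
  + by have := H (rshift p j); rewrite mul_mx_row !row_mxEr.
Qed.

Lemma convex_polyhedron_preimage (n m : nat) (M : 'M[R]_(n, m)) (c : 'rV_m)
    (P : set 'rV[R]_m) :
  convex_polyhedron P -> convex_polyhedron [set x | P (x *m M + c)]%classic.
Proof.
move=> [p [A [b ->]]]; exists p, (M *m A), (b - c *m A).
apply/seteqP; split => x /= H j; have := H j.
- by rewrite mulmxDl mulmxA mxE [X in _ -> _ <= X]mxE [X in _ -> _ <= _ + X]mxE lerBrDr.
- by rewrite mulmxDl mulmxA [X in _ -> X <= _]mxE [X in _ <= X -> _]mxE
     [X in _ <= _ + X -> _]mxE lerBrDr.
Qed.

Lemma finitely_piecewise_fin (n : nat) (X : set 'rV[R]_n) good (I : finType)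
    (P : I -> set 'rV[R]_n) :
  (forall i, convex_polyhedron (P i)) ->
  (forall x, X x -> exists i, P i x) ->
  (forall i, good (X `&` P i)%classic) -> finitely_piecewise X good.
Proof.
move=> H1 H2 H3; exists #|I|, (fun j => P (enum_val j)); split => //.
by move=> x /H2[i Pi]; exists (enum_rank i); rewrite enum_rankK.
Qed.

Lemma pl_map_linear (n m : nat) (X : set 'rV[R]_n) (f : 'rV[R]_n -> 'rV[R]_m)
    (M : 'M[R]_(n, m)) :
  (forall x, X x -> f x = x *m M) -> pl_map X f.
Proof.
move=> fM; apply: (@finitely_piecewise_fin _ _ _ unit (fun=> setT)).
- by move=> _; exact: convex_polyhedronT.
- by move=> x _; exists tt.
- by move=> _; exists M, 0 => x [Xx _]; rewrite addr0 fM.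
Qed.

Lemma pl_map_comp (n m l : nat) (X : set 'rV[R]_n) (Y : set 'rV[R]_m)
    (f : 'rV[R]_n -> 'rV[R]_m) (g : 'rV[R]_m -> 'rV[R]_l) :
  (forall x, X x -> Y (f x)) -> pl_map X f -> pl_map Y g -> pl_map X (g \o f).
Proof.
move=> XY [p [P [Pc PX Pf]]] [q [Q [Qc QY Qg]]].
have /boolp.choice[M /boolp.choice[c Mc]] i : exists (M : 'M[R]_(n, m)) (c : 'rV[R]_m),
   forall x, (X `&` P i)%classic x -> f x = x *m M + c by exact: Pf.
(* A piece of [g] is pulled back along the affine formula of [f] on [P i], which makes sense on the
   whole space and so has polyhedral preimages. *)
apply: (@finitely_piecewise_fin _ _ _ ('I_p * 'I_q)%type
  (fun ij => P ij.1 `&` [set x | Q ij.2 (x *m M ij.1 + c ij.1)])%classic).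
- move=> ij; apply: convex_polyhedronI => //.
  by apply: convex_polyhedron_preimage.
- move=> x Xx; have [i Pi] := PX _ Xx; have [j Qj] := QY _ (XY _ Xx).
  by exists (i, j); split => //=; rewrite -Mc.
- move=> [i j] /=; have [M' [c' Mc']] := Qg j.
  exists (M i *m M'), (c i *m M' + c') => x [Xx [Pi Qj]] /=.
  rewrite (Mc i)// Mc'; first by rewrite mulmxDl mulmxA addrA.
  by split => //; rewrite -(Mc i)//; exact: XY.
Qed.

Lemma pl_homeomorphic_trans (n m l : nat) (X : set 'rV[R]_n)
    (Y : set 'rV[R]_m) (Z : set 'rV[R]_l) :
  pl_homeomorphic X Y -> pl_homeomorphic Y Z -> pl_homeomorphic X Z.
Proof.
move=> [f [f' [pf pf' ff' f'f]]] [g [g' [pg pg' gg' g'g]]].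
exists (g \o f), (f' \o g'); split.
- by apply: pl_map_comp pf pg => x /ff'[].
- by apply: pl_map_comp pg' pf' => x /g'g[].
- by move=> x /ff'[Yf fx] /=; have [Zg ->] := gg' _ Yf.
- by move=> z /g'g[Yg gz] /=; have [Xf ->] := f'f _ Yg.
Qed.

Lemma pl_homeomorphic_sym (n m : nat) (X : set 'rV[R]_n) (Y : set 'rV[R]_m) :
  pl_homeomorphic X Y -> pl_homeomorphic Y X.
Proof. by move=> [f [g [? ? ? ?]]]; exists g, f; split. Qed.

Lemma pl_homeomorphic_refl (n : nat) (X : set 'rV[R]_n) : pl_homeomorphic X X.
Proof.
by exists id, id; split => //;
  apply: (@pl_map_linear _ _ _ _ 1%:M) => x _; rewrite mulmx1.
Qed.

End PiecewiseLinear.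

(** * Cones over simplicial complexes and linear maps between them *)

Section Cones.
Variable R : realType.

Definition supp (N : nat) (x : 'rV[R]_N) : {set 'I_N} :=
  [set v | x 0 v != 0]%SET.

Lemma suppP (N : nat) (x : 'rV[R]_N) (s : {set 'I_N}) :
  reflect (forall v, v \notin s -> x 0 v = 0) (supp x \subset s).
Proof.
apply: (iffP fintype.subsetP) => H v.
- by apply: contraNeq => xv; apply: H; rewrite inE.
- by rewrite inE; apply: contraNT => /H ->.
Qed.

Lemma supp_notin (N : nat) (x : 'rV[R]_N) v : v \notin supp x -> x 0 v = 0.
Proof. by rewrite inE negbK => /eqP. Qed.

Definition nneg (N : nat) (x : 'rV[R]_N) := forall v, 0 <= x 0 v.

(** Without the normalisation of the coordinate sum, points of one simplex can be added and scaled;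
    [realizationE] recovers the realization as the slice of sum 1. *)
Definition cone (N : nat) (K : {set {set 'I_N}}) (x : 'rV[R]_N) :=
  nneg x /\ supp x \in K.

Lemma realizationE (N : nat) (K : {set {set 'I_N}}) (x : 'rV[R]_N) :
  simplicial_complex K ->
  realization R K x <-> cone K x /\ \sum_v x 0 v = 1.
Proof.
move=> Kc; split.
- move=> [s sK [x0 x1 xs]]; split=> //; split=> //.
  by apply: Kc sK _; apply/suppP.
- move=> [[x0 xK] x1]; exists (supp x) => //; split=> // v; exact: supp_notin.
Qed.

Definition pos_part (N : nat) (x : 'rV[R]_N) : 'rV[R]_N :=
  \row_v (Num.max (x 0 v) 0).

Lemma pos_partB (N : nat) (x : 'rV[R]_N) : pos_part x - pos_part (- x) = x.
Proof.
apply/rowP => v; rewrite !mxE.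
by case: (lerP (x 0 v) 0) => ?; case: (lerP (- x 0 v) 0) => ?; lra.
Qed.

Lemma supp_pos_part (N : nat) (x : 'rV[R]_N) : supp (pos_part x) \subset supp x.
Proof. by apply/suppP => v; rewrite !inE negbK !mxE => /eqP ->; rewrite maxxx. Qed.

Lemma suppN (N : nat) (x : 'rV[R]_N) : supp (- x) = supp x.
Proof. by apply/setP => v; rewrite !inE mxE oppr_eq0. Qed.

Lemma nneg_pos_part (N : nat) (x : 'rV[R]_N) : nneg (pos_part x).
Proof. by move=> v; rewrite mxE le_max lexx orbT. Qed.

Definition cone_inj (N n : nat) (K : {set {set 'I_N}}) (A : 'M[R]_(N, n)) :=
  forall x y, cone K x -> cone K y -> x *m A = y *m A -> x = y.

(** The positive and the negative part of a linear relation on a simplex are two points of its cone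
    with the same image. *)
Lemma cone_inj_free (N n : nat) (K : {set {set 'I_N}}) (A : 'M[R]_(N, n)) x :
  simplicial_complex K -> cone_inj K A ->
  supp x \in K -> x *m A = 0 -> x = 0.
Proof.
move=> Kc Ki xK xA0.
rewrite -(pos_partB x); apply/eqP; rewrite subr_eq0; apply/eqP; apply: Ki.
- by split; [exact: nneg_pos_part|apply: Kc xK _; exact: supp_pos_part].
- split; [exact: nneg_pos_part|apply: Kc xK _].
  by rewrite -(suppN x) supp_pos_part.
- by apply/eqP; rewrite -subr_eq0 -mulmxBl pos_partB xA0.
Qed.

Definition restr (N : nat) (s : {set 'I_N}) : 'M[R]_N :=
  diag_mx (\row_v (v \in s)%:R).

Lemma restrE (N : nat) (s : {set 'I_N}) (x : 'rV[R]_N) v :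
  (x *m restr s) 0 v = x 0 v * (v \in s)%:R.
Proof. by rewrite mul_mx_diag !mxE. Qed.

Lemma restr_supp (N : nat) (s : {set 'I_N}) (x : 'rV[R]_N) :
  supp (x *m restr s) = supp x :&: s.
Proof.
by apply/setP => v; rewrite !inE restrE; case: (v \in s);
   rewrite ?mulr1 ?mulr0 ?eqxx ?andbT ?andbF.
Qed.

Lemma restr_id (N : nat) (s : {set 'I_N}) (x : 'rV[R]_N) :
  supp x \subset s -> x *m restr s = x.
Proof.
move=> /suppP H; apply/rowP => v; rewrite restrE.
by case: (boolP (v \in s)) => vs; rewrite ?mulr1// H// mul0r.
Qed.

Definition sel_mx (N : nat) (s : {set 'I_N}) : 'M[R]_(#|s|, N) :=
  \matrix_(i, v) (enum_val i == v)%:R.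

Lemma supp_sel (N : nat) (s : {set 'I_N}) (u : 'rV[R]_#|s|) :
  supp (u *m sel_mx s) \subset s.
Proof.
apply/suppP => v vs; rewrite mxE big1// => i _; rewrite mxE.
have [e|_] := eqVneq; last by rewrite mulr0.
by rewrite -e enum_valP in vs.
Qed.

Lemma sel_inj (N : nat) (s : {set 'I_N}) (u : 'rV[R]_#|s|) :
  u *m sel_mx s = 0 -> u = 0.
Proof.
move=> /rowP u0; apply/rowP => i; have := u0 (enum_val i).
rewrite !mxE (bigD1 i)//= mxE eqxx mulr1 big1 ?addr0// => j ji.
by rewrite mxE (inj_eq enum_val_inj) (negPf ji) mulr0.
Qed.

Lemma sel_surj (N : nat) (s : {set 'I_N}) (a : 'rV[R]_N) :
  supp a \subset s -> exists u, a = u *m sel_mx s.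
Proof.
move=> as_; exists (\row_i a 0 (enum_val i)); apply/rowP => v; rewrite mxE.
have [vs|vs] := boolP (v \in s); last first.
  rewrite (suppP _ _ as_)// big1// => i _; rewrite !mxE.
  have [e|_] := eqVneq; last by rewrite mulr0.
  by rewrite -e enum_valP in vs.
rewrite (bigD1 (enum_rank_in vs v))//= !mxE enum_rankK_in// eqxx mulr1.
rewrite big1 ?addr0// => i iv; rewrite !mxE.
have [e|_] := eqVneq; last by rewrite mulr0.
by case/eqP: iv; apply: enum_val_inj; rewrite enum_rankK_in.
Qed.

(** The left kernel of [B] kills [D] exactly when the columns of [D] lie in the column space of [B];
    [submx] speaks of row spaces, hence the transposes. *)
Lemma mulmx_factor (m n p : nat) (B : 'M[R]_(m, n)) (D : 'M[R]_(m, p)) :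
  (forall u : 'rV_m, u *m B = 0 -> u *m D = 0) -> exists Q, B *m Q = D.
Proof.
move=> H; have : (D^T <= B^T)%MS.
  rewrite submxE -trmx_eq0 trmx_mul trmxK; apply/eqP/row_matrixP => i.
  rewrite row_mul row0; apply: H.
  have /(congr1 trmx) := mulmx_coker B^T; rewrite trmx_mul trmxK trmx0 => E.
  by rewrite -row_mul E row0.
by move=> /submxP[Q DQ]; exists Q^T; rewrite -(trmxK D) DQ trmx_mul trmxK.
Qed.

Lemma cone_inj_inverse (N n : nat) (K : {set {set 'I_N}}) (A : 'M[R]_(N, n)) s :
  simplicial_complex K -> cone_inj K A -> s \in K ->
  exists Q, forall x : 'rV_N, supp x \subset s -> x *m A *m Q = x.
Proof.
move=> Kc Ki sK.
have [|Q HQ] := @mulmx_factor _ _ _ (restr s *m A) (restr s).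
  move=> u; rewrite mulmxA; apply: (cone_inj_free Kc Ki).
  by rewrite restr_supp; apply: Kc sK _; exact: subsetIr.
by exists Q => x xs; rewrite -{1}(restr_id xs) -2!mulmxA (mulmxA _ A) HQ restr_id.
Qed.

(** Rows of sum 1 preserve the coordinate sum, so the bijection of cones restricts to one of
    realizations. Its inverse is linear on the image of the cone over each simplex. *)
Lemma cone_iso_pl (N n : nat) (K : {set {set 'I_N}}) (L : {set {set 'I_n}})
    (A : 'M[R]_(N, n)) :
  simplicial_complex K -> simplicial_complex L ->
  (forall v, [set v]%SET \in K -> \sum_j A v j = 1) ->
  (forall x, cone K x -> cone L (x *m A)) ->
  cone_inj K A ->
  (forall y, cone L y -> exists2 x, cone K x & x *m A = y) ->
  pl_homeomorphic (realization R K) (realization R L).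
Proof.
move=> Kc Lc A1 AKL Ai As.
have sumA (x : 'rV_N) : cone K x -> \sum_j (x *m A) 0 j = \sum_v x 0 v.
  move=> [_ xK]; under eq_bigr do rewrite mxE.
  rewrite exchange_big /=; apply: eq_bigr => v _; rewrite -mulr_sumr.
  have [->|xv] := eqVneq (x 0 v) 0; first by rewrite mul0r.
  by rewrite A1 ?mulr1//; apply: Kc xK _; rewrite finset.sub1set inE.
have /boolp.choice[g gP] (y : 'rV_n) :
    exists x, cone L y -> cone K x /\ x *m A = y.
  case: (pselect (cone L y)) => [/As[x Kx xA]|nL]; first by exists x.
  by exists 0.
exists (mulmx^~ A), g; split.
- by apply: (@pl_map_linear _ _ _ _ _ A).
- have /boolp.choice[Q HQ] (s : {set 'I_N}) : exists Q, s \in K ->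
      forall x : 'rV_N, supp x \subset s -> x *m A *m Q = x.
    case: (boolP (s \in K)) => sK; last by exists 0.
    by have [Q HQ] := cone_inj_inverse Kc Ai sK; exists Q.
  (* [P s] is the image of the cone over [s]: the candidate preimage [y *m Q s] is nonnegative,
     supported in [s] and mapped to [y]. Equations are expressed by pairs of inequalities. *)
  pose P s := ([set y : 'rV[R]_n | forall v, (y *m (- col v (Q s))) 0 0 <= 0] `&`
    ([set y | forall v : {v | v \notin s}, (y *m (col (val v) (Q s))) 0 0 <= 0] `&`
    ([set y | forall v, (y *m (col v (Q s *m A - 1%:M))) 0 0 <= 0] `&`
    [set y | forall v, (y *m (- col v (Q s *m A - 1%:M))) 0 0 <= 0])))%classic.
  have PE s y : P s y <-> [/\ nneg (y *m Q s), supp (y *m Q s) \subset s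
                            & y *m Q s *m A = y].
    have colE m (B : 'M[R]_(n, m)) v : (y *m col v B) 0 0 = (y *m B) 0 v.
      by rewrite !mxE; apply: eq_bigr => k _; rewrite mxE.
    have NcolE m (B : 'M[R]_(n, m)) v : (y *m - col v B) 0 0 = - (y *m B) 0 v.
      by rewrite mulmxN mxE colE.
    split.
    - move=> [/= P1 [P2 [P3 P4]]]; split.
      + by move=> v; have := P1 v; rewrite NcolE oppr_le0.
      + apply/suppP => v vs; have := P1 v; have := P2 (exist _ v vs).
        rewrite colE NcolE /= oppr_le0 => a b; apply/eqP.
        by rewrite eq_le a.
      + apply/eqP; rewrite -subr_eq0; apply/eqP/rowP => v.
        have := P3 v; have := P4 v; rewrite colE NcolE mulmxBr mulmx1 mulmxA.
        by rewrite oppr_le0 [in RHS]mxE => a b; apply/eqP; rewrite eq_le b.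
    - move=> [P1 /suppP P2 P3]; split; [|split; [|split]] => /=.
      + by move=> v; rewrite NcolE oppr_le0.
      + by move=> [v vs]; rewrite colE /= P2.
      + by move=> v; rewrite colE mulmxBr mulmx1 mulmxA P3 subrr mxE.
      + by move=> v; rewrite NcolE mulmxBr mulmx1 mulmxA P3 subrr mxE oppr0.
  apply: (@finitely_piecewise_fin _ _ _ _ {s | s \in K} (fun s => P (val s))).
  + move=> s; do !apply: convex_polyhedronI; exact: convex_polyhedron_fin.
  + move=> y /(realizationE _ Lc)[Ly _]; have [[x0 xK] xA] := gP _ Ly.
    exists (exist (fun s => s \in K) _ xK); apply/PE => /=.
    have gQ : y *m Q (supp (g y)) = g y by rewrite -{1}xA HQ.
    by rewrite gQ; split.
  + move=> [s sK] /=; exists (Q s), 0 => y [/(realizationE _ Lc)[Ly _]].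
    move=> /PE[y0 ys yA]; rewrite addr0; have [Kg gA] := gP _ Ly.
    apply: Ai => //; last by rewrite gA yA.
    by split=> //; apply: Kc sK _.
- move=> x /(realizationE _ Kc)[Kx x1]; have Lx := AKL _ Kx.
  split; first by apply/realizationE => //; rewrite sumA.
  by have [Kg gA] := gP _ Lx; exact: Ai.
- move=> y /(realizationE _ Lc)[Ly y1]; have [Kg gA] := gP _ Ly.
  by split=> //; apply/realizationE => //; rewrite -sumA// gA.
Qed.

End Cones.

(** * Complete fans, starring of edges and cuts by hyperplanes *)

Section Fans.
Variable R : realType.

(* The cones over the simplices of K, with the vertex v placed at row v P, form a
   complete simplicial fan. *)
Definition fan (N n : nat) (K : {set {set 'I_N}}) (P : 'M[R]_(N, n)) :=
  cone_inj K P /\ forall y, exists2 x, cone K x & x *m P = y.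

Section Starring.
Variables (N : nat) (K : {set {set 'I_N}}) (a b : 'I_N) (al be : R).
Hypotheses (Kc : simplicial_complex K) (ab : a != b).
Hypotheses (al0 : 0 < al) (be0 : 0 < be) (al_be : al + be = 1).

Definition star_pt : 'rV[R]_N := al *: delta_mx 0 a + be *: delta_mx 0 b.

Definition star_mx : 'M[R]_(1 + N, N) := col_mx star_pt 1%:M.

(* The new vertex is [lshift N ord0]; the old vertex v becomes [rshift 1 v]. *)
Definition old_part (s : {set 'I_(1 + N)}) : {set 'I_N} :=
  [set v | rshift 1 v \in s]%SET.

(** The carrier of [s]: the least set of old vertices whose simplex contains the starred simplex
    [s]. *)
Definition star_image (s : {set 'I_(1 + N)}) : {set 'I_N} :=
  if lshift N ord0 \in s then ([set a; b] :|: old_part s)%SET else old_part s.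

Definition star_edge : {set {set 'I_(1 + N)}} :=
  [set s | (star_image s \in K) && ~~ ([set a; b]%SET \subset old_part s)]%SET.

Lemma old_partS (s t : {set 'I_(1 + N)}) : s \subset t -> old_part s \subset old_part t.
Proof. by move=> /fintype.subsetP H; apply/fintype.subsetP => v; rewrite !inE => /H. Qed.

Lemma star_edge_complex : simplicial_complex star_edge.
Proof.
move=> s t; rewrite !inE => /andP[sK sab] ts; apply/andP; split; last first.
  by apply: contra sab => /fintype.subset_trans; apply; exact: old_partS.
apply: Kc sK _; have := old_partS ts; rewrite /star_image.
case: ifP => [/(fintype.subsetP ts) -> |_]; first by move=> H; rewrite finset.setUS.
case: ifP => // _ H; apply: fintype.subset_trans H _; exact: finset.subsetUr.
Qed.

Lemma star_ptE v : star_pt 0 v = al * (v == a)%:R + be * (v == b)%:R.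
Proof. by rewrite !mxE !eqxx. Qed.

Lemma star_mxE (x : 'rV[R]_(1 + N)) v :
  (x *m star_mx) 0 v = x 0 (lshift N ord0) * star_pt 0 v + x 0 (rshift 1 v).
Proof.
rewrite -{1}(hsubmxK x) mul_row_col mulmx1 mxE [rsubmx x 0 v]mxE; congr (_ + _).
by rewrite mxE big_ord1 mxE.
Qed.

Lemma star_pt_ge0 v : 0 <= star_pt 0 v.
Proof. by rewrite star_ptE addr_ge0// mulr_ge0// ?ler0n// ltW. Qed.

Lemma star_pt_eq0 v : (star_pt 0 v == 0) = (v \notin [set a; b]%SET).
Proof.
rewrite star_ptE !inE; have [->|va] /= := eqVneq v a.
  by rewrite (negPf ab) mulr0 mulr1 addr0 gt_eqF.
by have [_|_] := eqVneq v b; rewrite ?mulr0 ?mulr1 ?add0r ?eqxx// gt_eqF.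
Qed.

Lemma supp_star_mx x : nneg x -> supp (x *m star_mx) = star_image (supp x).
Proof.
move=> x0; apply/setP => v; rewrite /star_image.
have -> : (v \in supp (x *m star_mx)) =
   (x 0 (lshift N ord0) != 0) && (v \in [set a; b]%SET) || (x 0 (rshift 1 v) != 0).
  rewrite inE star_mxE paddr_eq0 ?mulr_ge0 ?star_pt_ge0//.
  by rewrite mulf_eq0 star_pt_eq0 negb_and negb_or negbK.
by rewrite [lshift N ord0 \in _]inE; case: ifP => _; rewrite !inE ?orbA.
Qed.

Lemma cone_star_edge x : nneg x ->
  cone star_edge x <-> cone K (x *m star_mx) /\
    ~~ ((x 0 (rshift 1 a) != 0) && (x 0 (rshift 1 b) != 0)).
Proof.
move=> x0; rewrite /cone (supp_star_mx x0) inE.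
have -> : ([set a; b]%SET \subset old_part (supp x)) =
    (x 0 (rshift 1 a) != 0) && (x 0 (rshift 1 b) != 0).
  by rewrite finset.subUset !finset.sub1set !inE.
split=> [[_ /andP[-> ->]]|[[_ ->] ->]]; split=> //; split=> // v.
by rewrite star_mxE addr_ge0// mulr_ge0// star_pt_ge0.
Qed.

(** The image determines the coefficient of the new vertex: since the coefficient of [a] or of [b]
    vanishes, it is the largest multiple of [star_pt] that can be subtracted without leaving the
    nonnegative orthant. *)
Lemma star_edge_inj : cone_inj star_edge star_mx.
Proof.
move=> x y Kx Ky xy; have [[x0 _] [y0 _]] := (Kx, Ky).
move: Kx Ky => /(cone_star_edge x0)[_ xab] /(cone_star_edge y0)[_ yab].
have E v : x 0 (lshift N ord0) * star_pt 0 v + x 0 (rshift 1 v) =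
           y 0 (lshift N ord0) * star_pt 0 v + y 0 (rshift 1 v).
  by rewrite -!star_mxE xy.
have pa : 0 < star_pt 0 a by rewrite star_ptE eqxx (negPf ab) mulr1 mulr0 addr0.
have pb : 0 < star_pt 0 b.
  by rewrite star_ptE eqxx eq_sym (negPf ab) mulr1 mulr0 add0r.
have key (x' y' : 'rV[R]_(1 + N)) : nneg y' ->
   ~~ ((x' 0 (rshift 1 a) != 0) && (x' 0 (rshift 1 b) != 0)) ->
   (forall v, x' 0 (lshift N ord0) * star_pt 0 v + x' 0 (rshift 1 v) =
              y' 0 (lshift N ord0) * star_pt 0 v + y' 0 (rshift 1 v)) ->
   y' 0 (lshift N ord0) <= x' 0 (lshift N ord0).
  move=> y'0; rewrite negb_and !negbK => xab' E'; rewrite leNgt; apply/negP => lt.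
  have H v : 0 < star_pt 0 v -> 0 < x' 0 (rshift 1 v).
    move=> pv; have := E' v; have := y'0 (rshift 1 v).
    have : 0 < (y' 0 (lshift N ord0) - x' 0 (lshift N ord0)) * star_pt 0 v.
      by rewrite mulr_gt0// subr_gt0.
    rewrite mulrBl; lra.
  by case/orP: xab' => /eqP e; [have := H _ pa|have := H _ pb]; rewrite e ltxx.
have t : x 0 (lshift N ord0) = y 0 (lshift N ord0).
  by apply/eqP; rewrite eq_le !key.
apply/rowP => v; rewrite -(fintype.splitK v).
case: (fintype.split v) => w /=; first by rewrite (ord1 w) t.
by have := E w; rewrite t => /addrI.
Qed.

Lemma star_edge_surj y : cone K y -> exists2 x, cone star_edge x & x *m star_mx = y.
Proof.
(* This is the largest multiple of [star_pt] that can be split off; one of the coefficients of [a]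
   and [b] then becomes 0. *)
move=> [y0 yK]; pose t := Num.min (y 0 a / al) (y 0 b / be).
have t0 : 0 <= t by rewrite le_min !divr_ge0// ltW.
have ta : t * al <= y 0 a by rewrite -ler_pdivlMr// ge_min lexx.
have tb : t * be <= y 0 b by rewrite -ler_pdivlMr// ge_min lexx orbT.
pose x : 'rV[R]_(1 + N) := row_mx t%:M (y - t *: star_pt).
have xn : x 0 (lshift N ord0) = t by rewrite row_mxEl mxE eqxx.
have xo v : x 0 (rshift 1 v) = y 0 v - t * star_pt 0 v.
  by rewrite row_mxEr !mxE.
have xa : x 0 (rshift 1 a) = y 0 a - t * al.
  by rewrite xo star_ptE eqxx (negPf ab) mulr1 mulr0 addr0.
have xb : x 0 (rshift 1 b) = y 0 b - t * be.
  by rewrite xo star_ptE eqxx eq_sym (negPf ab) mulr1 mulr0 add0r.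
have x0 : nneg x.
  move=> v; rewrite -(fintype.splitK v); case: (fintype.split v) => w /=.
    by rewrite (ord1 w) xn.
  have [->|wa] := eqVneq w a; first by rewrite xa subr_ge0.
  have [->|wb] := eqVneq w b; first by rewrite xb subr_ge0.
  by rewrite xo star_ptE (negPf wa) (negPf wb) !mulr0 addr0 mulr0 subr0.
have xy : x *m star_mx = y.
  by apply/rowP => v; rewrite star_mxE xn xo addrC subrK.
exists x => //; apply/cone_star_edge => //; rewrite xy; split=> //.
rewrite negb_and !negbK xa xb !subr_eq0.
have [le|lt] := leP (y 0 a / al) (y 0 b / be).
- by rewrite /t (min_idPl le) divfK ?eqxx// gt_eqF.
- by rewrite /t (min_idPr (ltW lt)) divfK ?eqxx ?orbT// gt_eqF.
Qed.

Lemma star_edge_pl : pl_homeomorphic (realization R K) (realization R star_edge).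
Proof.
apply: pl_homeomorphic_sym; apply: (@cone_iso_pl _ _ _ _ _ star_mx) => //.
- exact: star_edge_complex.
- have ind (c : 'I_N) : \sum_i (i == c)%:R = 1 :> R.
    by rewrite (bigD1 c)//= eqxx big1 ?addr0// => i /negPf ->.
  move=> v _; rewrite -(fintype.splitK v); case: (fintype.split v) => w /=.
    rewrite (eq_bigr (fun i => al * (i == a)%:R + be * (i == b)%:R)).
      by rewrite big_split /= -!mulr_sumr !ind !mulr1.
    by move=> i _; rewrite col_mxEu (ord1 w) star_ptE.
  rewrite (eq_bigr (fun i => (i == w)%:R)) ?ind// => i _.
  by rewrite col_mxEd mxE eq_sym.
- by move=> x Kx; have [x0 _] := Kx; have [] := (cone_star_edge x0).1 Kx.
- exact: star_edge_inj.
- exact: star_edge_surj.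
Qed.

Lemma star_edge_fan (n : nat) (P : 'M[R]_(N, n)) :
  fan K P -> fan star_edge (star_mx *m P).
Proof.
move=> [Pi Ps]; split.
- move=> x y Kx Ky; rewrite !mulmxA => /Pi E; apply: star_edge_inj => //.
  have [[x0 _] [y0 _]] := (Kx, Ky).
  by apply: E; [have [] := (cone_star_edge x0).1 Kx
               |have [] := (cone_star_edge y0).1 Ky].
- move=> y; have [x Kx xP] := Ps y; have [z Kz zx] := star_edge_surj Kx.
  by exists z => //; rewrite mulmxA zx.
Qed.

End Starring.


Definition placed (N n : nat) (P : 'M[R]_(N, n)) (g : 'cV[R]_n) v := (P *m g) v 0.

(** Each edge cut by the hyperplane p = 0 is counted once, with its positive end first; this count
    is the measure of the induction in [fan_cut]. *)
Definition crossings (N : nat) (K : {set {set 'I_N}}) (p : 'I_N -> R) :=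
  [set e : 'I_N * 'I_N |
     [&& [set e.1; e.2]%SET \in K, 0 < p e.1 & p e.2 < 0]]%SET.

Definition uncut (N n : nat) (K : {set {set 'I_N}}) (P : 'M[R]_(N, n)) g :=
  crossings K (placed P g) == finset.set0.

Lemma uncutP (N n : nat) (K : {set {set 'I_N}}) (P : 'M[R]_(N, n)) g :
  simplicial_complex K ->
  reflect (forall s v w, s \in K -> v \in s -> w \in s ->
             0 < placed P g v -> 0 <= placed P g w) (uncut K P g).
Proof.
move=> Kc; apply: (iffP eqP) => [H s v w sK vs ws pv|H].
- rewrite leNgt; apply/negP => pw.
  have : (v, w) \in crossings K (placed P g).
    rewrite inE /= pv pw !andbT; apply: Kc sK _.
    by rewrite finset.subUset !finset.sub1set vs ws.
  by rewrite H inE.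
- apply/setP => -[v w]; rewrite !inE /=; apply/negbTE/negP => /and3P[vwK pv].
  by rewrite ltNge (H _ v w vwK) ?inE ?eqxx ?orbT.
Qed.

Section Cutting.
Variables (N n : nat) (K : {set {set 'I_N}}) (P : 'M[R]_(N, n)).
Variables (a b : 'I_N) (al be : R).
Hypotheses (Kc : simplicial_complex K) (ab : a != b).
Hypotheses (al0 : 0 < al) (be0 : 0 < be).

Let P' := star_mx a b al be *m P.

Lemma placed_old g v : placed P' g (rshift 1 v) = placed P g v.
Proof.
rewrite /placed /P' -mulmxA.
by rewrite mul_col_mx mul1mx col_mxEd.
Qed.

Lemma placed_new g :
  placed P' g (lshift N ord0) = al * placed P g a + be * placed P g b.
Proof.
rewrite /placed /P' -mulmxA mul_col_mx col_mxEu mulmxDl -!scalemxAl -!rowE.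
by rewrite !mxE.
Qed.

(** The carrier of a starred simplex lies on one side of the hyperplane, and the new vertex is a
    positive combination of two of its vertices. Hence hyperplanes treated earlier stay
    uncrossed. *)
Lemma uncut_star g : uncut K P g -> uncut (star_edge K a b) P' g.
Proof.
move=> /(uncutP _ _ Kc) H; apply/uncutP; first exact: star_edge_complex.
have lift (s : {set 'I_(1 + N)}) v : v \in s ->
    0 < placed P' g v -> exists2 v', v' \in star_image a b s & 0 < placed P g v'.
  rewrite -(fintype.splitK v); case: (fintype.split v) => w /= ws.
    rewrite (ord1 w) in ws *; rewrite placed_new => p0.
    have [pa|pa] := ltP 0 (placed P g a).
      by exists a => //; rewrite /star_image ws !inE eqxx.
    exists b; first by rewrite /star_image ws !inE eqxx orbT.
    rewrite ltNge; apply/negP => pb; move: p0; rewrite ltNge.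
    by rewrite -oppr_ge0 opprD -!mulrN addr_ge0// mulr_ge0 ?oppr_ge0// ltW.
  rewrite placed_old => p0; exists w => //.
  by rewrite /star_image; case: ifP => _; rewrite !inE ?ws ?orbT.
move=> s v w; rewrite inE => /andP[sK _] vs ws /(lift _ _ vs)[v' v's pv'].
move: ws; rewrite -(fintype.splitK w); case: (fintype.split w) => u /= us.
  rewrite (ord1 u) in us *; rewrite placed_new.
  have pc c : c \in [set a; b]%SET -> 0 <= placed P g c.
    move=> cab; apply: (H _ v' c sK) => //.
    by rewrite /star_image us finset.in_setU cab.
  by rewrite addr_ge0// mulr_ge0 ?pc ?inE ?eqxx ?orbT// ltW.
rewrite placed_old; apply: (H _ v' u sK) => //.
by rewrite /star_image; case: ifP => _; rewrite !inE ?us ?orbT.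
Qed.

(** The new vertex lies on the hyperplane, so no crossing edge contains it; the crossing edges that
    remain are old ones, and [(a, b)] is gone. *)
Lemma crossings_star g : [set a; b]%SET \in K ->
  0 < placed P g a -> placed P g b < 0 ->
  al * placed P g a + be * placed P g b = 0 ->
  (#|crossings (star_edge K a b) (placed P' g)| < #|crossings K (placed P g)|)%N.
Proof.
move=> abK pa pb pab0.
have abX : (a, b) \in crossings K (placed P g) by rewrite inE /= abK pa.
rewrite [ltnRHS](cardsD1 (a, b)) abX ltnS.
pose f (e : 'I_N * 'I_N) := (rshift 1 e.1, rshift 1 e.2).
apply: (@leq_trans #|f @: (crossings K (placed P g) :\ (a, b))|); last first.
  exact: leq_imset_card.
apply: subset_leq_card; apply/fintype.subsetP => -[v w].
rewrite -(fintype.splitK v) -(fintype.splitK w).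
case: (fintype.split v) => v'; last case: (fintype.split w) => w' /=.
- by rewrite (ord1 v') !inE /= placed_new pab0 ltxx andbF.
- by rewrite (ord1 w') !inE /= placed_new pab0 ltxx !andbF.
rewrite !inE /= !placed_old => /and3P[/andP[vwK vwab] pv pw].
have oldE : old_part [set rshift 1 v'; rshift 1 w']%SET = [set v'; w']%SET.
  by apply/setP => u; rewrite !inE !(inj_eq (@rshift_inj _ _)).
apply/imsetP; exists (v', w') => //; rewrite !inE /= pv pw !andbT.
apply/andP; split.
  by apply: contra vwab => /eqP[va wb]; rewrite oldE va wb fintype.subxx.
by move: vwK; rewrite /star_image !inE /= oldE.
Qed.

End Cutting.

Lemma fan_cut (N n : nat) (K : {set {set 'I_N}}) (P : 'M[R]_(N, n))
    (g : 'cV[R]_n) (G : seq 'cV[R]_n) :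
  simplicial_complex K -> fan K P -> all (uncut K P) G ->
  exists (N' : nat) (K' : {set {set 'I_N'}}) (P' : 'M[R]_(N', n)),
    [/\ simplicial_complex K', fan K' P', all (uncut K' P') (g :: G) &
        pl_homeomorphic (realization R K) (realization R K')].
Proof.
have [m] := ubnP #|crossings K (placed P g)|.
elim: m => // m IH in N K P * => leK Kc KP KG.
have [cut0|[[a b]]] := set_0Vmem (crossings K (placed P g)).
  exists N, K, P; split=> //=; first by rewrite KG /uncut cut0 eqxx.
  exact: pl_homeomorphic_refl.
rewrite inE /= => /and3P[abK pa pb].
have ab : a != b by apply: contraTneq pa => ->; rewrite -leNgt ltW.
have d0 : 0 < placed P g a - placed P g b by rewrite subr_gt0 (lt_trans pb).
(* These weights put the new vertex on the hyperplane g = 0. *)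
pose al := - placed P g b / (placed P g a - placed P g b).
pose be := placed P g a / (placed P g a - placed P g b).
have al0 : 0 < al by rewrite divr_gt0// oppr_gt0.
have be0 : 0 < be by rewrite divr_gt0.
have al_be : al + be = 1 by rewrite -mulrDl addrC divff// gt_eqF.
have albe0 : al * placed P g a + be * placed P g b = 0.
  by rewrite /al /be mulrAC [X in _ + X]mulrAC -mulrDl mulNr (mulrC (placed P g b)) addNr mul0r.
have [||||N' [K' [P' [K'c K'P' K'G KK']]]] :=
  IH _ (star_edge K a b) (star_mx a b al be *m P).
- rewrite ltnS in leK; apply: leq_trans leK; exact: crossings_star.
- exact: star_edge_complex.
- exact: star_edge_fan.
- by apply/allP => g' /(allP KG); apply: uncut_star.
exists N', K', P'; split=> //; apply: pl_homeomorphic_trans KK'.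
exact: (star_edge_pl Kc ab al0 be0 al_be).
Qed.

Lemma fan_cuts (N n : nat) (K : {set {set 'I_N}}) (P : 'M[R]_(N, n))
    (G : seq 'cV[R]_n) :
  simplicial_complex K -> fan K P ->
  exists (N' : nat) (K' : {set {set 'I_N'}}) (P' : 'M[R]_(N', n)),
    [/\ simplicial_complex K', fan K' P', all (uncut K' P') G &
        pl_homeomorphic (realization R K) (realization R K')].
Proof.
move=> Kc KP; elim: G => [|g G [N' [K' [P' [K'c K'P' K'G KK']]]]].
  by exists N, K, P; split=> //; exact: pl_homeomorphic_refl.
have [N2 [K2 [P2 [? ? ? K'K2]]]] := fan_cut g K'c K'P' K'G.
exists N2, K2, P2; split=> //; exact: pl_homeomorphic_trans K'K2.
Qed.

End Fans.

(** * Fans that refine the fan of a simplex *)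

Section FanSphere.
Variables (R : realType) (N n : nat) (K : {set {set 'I_N}}) (P : 'M[R]_(N, n)).

(* y in R^n is viewed as the class of (0, y) in R^(n+1) modulo (1, ..., 1). *)
Definition pad_mx : 'M[R]_(n, n.+1) := \matrix_(l, k) (k == lift ord0 l)%:R.

Definition coord_diff (i j : 'I_n.+1) : 'cV[R]_n := col i pad_mx - col j pad_mx.

Lemma placed_coord_diff i j v :
  placed P (coord_diff i j) v = (P *m pad_mx) v i - (P *m pad_mx) v j.
Proof.
have colE (k : 'I_n.+1) : (P *m col k pad_mx) v 0 = (P *m pad_mx) v k.
  by rewrite !mxE; apply: eq_bigr => l _; rewrite [col _ _ _ _]mxE.
have subE (U V : 'cV[R]_N) : (U - V) v 0 = U v 0 - V v 0 by rewrite !mxE.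
by rewrite /placed mulmxBr subE !colE.
Qed.

Lemma pad_mx0 (m : nat) (y : 'M[R]_(m, n)) v : (y *m pad_mx) v ord0 = 0.
Proof. by rewrite mxE big1// => l _; rewrite mxE (negPf (neq_lift _ _)) mulr0. Qed.

Lemma pad_mxS (m : nat) (y : 'M[R]_(m, n)) v i :
  (y *m pad_mx) v (lift ord0 i) = y v i.
Proof.
rewrite mxE (bigD1 i)//= mxE eqxx mulr1 big1 ?addr0// => l li.
by rewrite mxE (inj_eq lift_inj) eq_sym (negPf li) mulr0.
Qed.

Hypotheses (Kc : simplicial_complex K) (KP : fan K P).
Hypothesis Kunc : forall i j, uncut K P (coord_diff i j).

(** The class of [P v] modulo (1, ..., 1) has exactly one representative with minimum 0, and this
    lies in the cone over the boundary of the n-simplex. Scaled to sum 1, it becomes row v of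
    [A]. *)
Let c v i := (P *m pad_mx) v i -
  (P *m pad_mx) v [arg min_(j < ord0) (P *m pad_mx) v j]%O.
Let tot v := \sum_i c v i.
Let A : 'M[R]_(N, n.+1) := \matrix_(v, i) (c v i / tot v).

Let c_ge0 v i : 0 <= c v i.
Proof. by rewrite /c; case: Order.TotalTheory.arg_minP => // j _ H; rewrite subr_ge0 H. Qed.

Let tot_ge0 v : 0 <= tot v.
Proof. by apply: sumr_ge0 => i _. Qed.

(** An index minimising the sum over [s] minimises at each vertex: if k were smaller than j at one
    vertex, it would be at most j at all of them, and its sum would be smaller. So the
    representatives with minimum 0 are linear on each cone. *)
Let common_min s : s \in K -> exists j, forall v i, v \in s ->
  c v i = (P *m pad_mx) v i - (P *m pad_mx) v j.
Proof.
move=> sK.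
pose S i := \sum_(v in s) (P *m pad_mx) v i.
have [j Sj] : exists j, forall k, S j <= S k.
  exists [arg min_(j < ord0) S j]%O.
  by case: Order.TotalTheory.arg_minP => // j _ H k; exact: H.
exists j => v i vs.
suff jmin k : (P *m pad_mx) v j <= (P *m pad_mx) v k.
  rewrite /c; case: Order.TotalTheory.arg_minP => // j' _ H; congr (_ - _).
  by apply/le_anti/andP; split; [exact: H|exact: jmin].
rewrite leNgt; apply/negP => lt.
have pos u : u \in s -> (P *m pad_mx) u k <= (P *m pad_mx) u j.
  move=> us; have /(uncutP _ _ Kc)/(_ s v u sK vs us) := Kunc j k.
  by rewrite !placed_coord_diff subr_ge0; apply; rewrite subr_gt0.
have : S k < S j.
  rewrite /S (bigD1 v)//= [ltRHS](bigD1 v)//= ltr_leD//.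
  by apply: ler_sum => u /andP[us _]; exact: pos.
by apply/negP; rewrite -leNgt.
Qed.

Let tot_gt0 v : [set v]%SET \in K -> 0 < tot v.
Proof.
move=> vK; rewrite lt_neqAle tot_ge0 andbT eq_sym; apply/negP => /eqP t0.
have c0 i : c v i = 0.
  apply/eqP; have /eqP := t0; rewrite /tot psumr_eq0; last by move=> k _.
  by move=> /allP H; apply: H; rewrite mem_index_enum.
have Pv : row v P = 0.
  apply/rowP => i; rewrite [LHS]mxE [RHS]mxE -(pad_mxS P).
  have := c0 (lift ord0 i); have := c0 ord0; rewrite /c pad_mx0; lra.
have [Pi _] := KP.
have supp1 : supp (delta_mx 0 v : 'rV[R]_N) = [set v]%SET.
  apply/setP => u; rewrite !inE mxE eqxx /=.
  by have [_|_] := eqVneq u v; rewrite /= ?oner_eq0 ?eqxx.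
have : delta_mx 0 v = 0 :> 'rV[R]_N.
  apply: Pi; last by rewrite -rowE Pv mul0mx.
  - by split; [move=> u; rewrite mxE ler0n|rewrite supp1].
  - split; first by move=> u; rewrite mxE.
    by apply: Kc vK _; apply/suppP => u _; rewrite mxE.
by move=> /rowP/(_ v)/eqP; rewrite !mxE !eqxx oner_eq0.
Qed.

Let in_supp (x : 'rV[R]_N) v : supp x \in K -> x 0 v != 0 -> 0 < tot v.
Proof.
by move=> xK xv; apply/tot_gt0/(Kc xK); rewrite finset.sub1set inE.
Qed.

(** Row v of [A] represents [P v] divided by [tot v]; dividing the weights of x in the same way
    transfers injectivity from [P] to [A]. *)
Let wt (x : 'rV[R]_N) : 'rV[R]_N := \row_v (x 0 v / tot v).

Let wtE (x : 'rV[R]_N) : (forall i, (wt x *m P) 0 i = (x *m A) 0 (lift ord0 i) - (x *m A) 0 ord0).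
Proof.
move=> i; rewrite !mxE -sumrB; apply: eq_bigr => v _.
rewrite !mxE -mulrBr -mulrBl /c opprB addrA subrK pad_mx0 subr0.
by have := pad_mxS P v i; rewrite mxE => ->; rewrite mulrAC mulrA.
Qed.

Let supp_wt x : supp (wt x) \subset supp x.
Proof. by apply/suppP => v /supp_notin xv; rewrite mxE xv mul0r. Qed.

Let cone_wt x : cone K x -> cone K (wt x).
Proof.
move=> [x0 xK]; split; first by move=> v; rewrite mxE divr_ge0.
exact: Kc xK (supp_wt x).
Qed.

Lemma uncut_fan_pl_sphere : pl_sphere R n K.
Proof.
have [Pi Ps] := KP.
apply: (@cone_iso_pl _ _ _ _ _ A) => //.
- move=> s t; rewrite !inE => sT ts; apply: contra sT => /eqP tT.
  by rewrite -finset.subTset -tT.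
- move=> v vK; under eq_bigr do rewrite mxE.
  by rewrite -mulr_suml divff// gt_eqF// tot_gt0.
- move=> x [x0 xK]; split.
    move=> i; rewrite mxE sumr_ge0// => v _; rewrite mulr_ge0// mxE.
    by rewrite divr_ge0.
  have [j jP] := common_min xK; rewrite inE; apply/negP => /eqP/setP/(_ j).
  rewrite !inE mxE => /negP; apply; apply/eqP; rewrite big1// => v _.
  have [->|xv] := eqVneq (x 0 v) 0; first by rewrite mul0r.
  by rewrite mxE jP ?inE// subrr mul0r mulr0.
- move=> x y Kx Ky xy.
  have : wt x = wt y.
    apply: Pi; [exact: cone_wt|exact: cone_wt|].
    by apply/rowP => i; rewrite !wtE xy.
  move=> /rowP H; apply/rowP => v; have := H v; rewrite !mxE.
  (* [tot v] vanishes only if v is not a vertex of [K], and then both coordinates are 0. *)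
  have [t0 _|t0] := eqVneq (tot v) 0; last by move/(divIf t0).
  have zero (z : 'rV[R]_N) : cone K z -> z 0 v = 0.
    move=> [_ zK]; apply/eqP; apply: contraT => /(in_supp zK).
    by rewrite t0 ltxx.
  by rewrite !zero.
- move=> z [z0]; rewrite inE => zT.
  (* The point of R^n that stands for the class of z modulo (1, ..., 1). *)
  have [y [x0 xK] yP] := Ps (\row_i (z 0 (lift ord0 i) - z 0 ord0)).
  pose x : 'rV[R]_N := \row_v (y 0 v * tot v).
  have sxy : supp x \subset supp y.
    by apply/suppP => v /supp_notin yv; rewrite mxE yv mul0r.
  exists x; first by split; [move=> v; rewrite mxE mulr_ge0|exact: Kc xK sxy].
  have [j jP] := common_min xK.
  have xA i : (x *m A) 0 i = z 0 i - z 0 j.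
    have -> : (x *m A) 0 i = (y *m P *m pad_mx) 0 i - (y *m P *m pad_mx) 0 j.
      rewrite -mulmxA [LHS]mxE [X in X - _]mxE [X in _ - X]mxE -sumrB.
      apply: eq_bigr => v _.
      have [y0|yv] := eqVneq (y 0 v) 0; first by rewrite !mxE y0 !mul0r subrr.
      have /gt_eqF t0 := in_supp xK yv.
      by rewrite -mulrBr -jP ?inE// [x 0 v]mxE [A v i]mxE mulrACA divff ?t0// mulr1.
    rewrite yP.
    have pz k : (\row_i (z 0 (lift ord0 i) - z 0 ord0) *m pad_mx) 0 k = z 0 k - z 0 ord0.
      case: (unliftP ord0 k) => [k' ->|->]; first by rewrite pad_mxS mxE.
      by rewrite pad_mx0 subrr.
    by rewrite !pz opprB addrA subrK.
  (* As z lies over the boundary of the simplex, it has a zero coordinate. There z minus [z 0 j] is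
     nonnegative, which forces [z 0 j] to be 0. *)
  have [j0 zj0] : exists j0, z 0 j0 = 0.
    have : supp z \proper [set: 'I_n.+1]%SET by rewrite finset.properT.
    by move=> /properP[_ [j0 _ /supp_notin]]; exists j0.
  have zj : z 0 j = 0.
    have : 0 <= (x *m A) 0 j0.
      rewrite mxE sumr_ge0// => v _; rewrite !mxE mulr_ge0//.
        by rewrite mulr_ge0.
      by rewrite divr_ge0.
    by rewrite xA zj0 sub0r oppr_ge0 => le; apply/le_anti; rewrite le z0.
  by apply/rowP => i; rewrite xA zj subr0.
Qed.

End FanSphere.

Theorem fan_pl_sphere (R : realType) (N n : nat) (K : {set {set 'I_N}})
    (P : 'M[R]_(N, n)) :
  simplicial_complex K -> fan K P -> pl_sphere R n K.
Proof.
move=> Kc KP.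
have [N' [K' [P' [K'c K'P' K'G KK']]]] :=
  fan_cuts [seq coord_diff R i j | i <- enum 'I_n.+1, j <- enum 'I_n.+1] Kc KP.
apply: pl_homeomorphic_trans KK' _; apply: uncut_fan_pl_sphere K'P' _ => // i j.
by apply: (allP K'G); apply/allpairsP; exists (i, j); rewrite /= !mem_enum.
Qed.

(** * Symmetric fans modulo the antipodal map, and their links *)

Lemma in_link (N : nat) (K : {set {set 'I_N}}) (s t : {set 'I_N}) :
  (t \in link K s) = [&& t \in K, [disjoint t & s] & (t :|: s)%SET \in K].
Proof. by rewrite inE. Qed.

Section SignedFans.
Variables (R : realType) (N n : nat) (F : finType) (eps : F -> 'I_N -> R).
Variable P : 'M[R]_(N, n).

(* [eps f v] is the sign with which the vertex v occurs in the signed simplex f,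
   and 0 if it does not occur. *)
Definition fsupp f : {set 'I_N} := [set v | eps f v != 0]%SET.

Definition signed_complex : {set {set 'I_N}} :=
  [set s : {set 'I_N} | [exists f, s \subset fsupp f]]%SET.

Definition scone f (z : 'rV[R]_N) :=
  forall v, 0 <= eps f v * z 0 v /\ (eps f v = 0 -> z 0 v = 0).

Lemma scone_abs f z v : [\/ eps f v = 0, eps f v = 1 | eps f v = -1] ->
  scone f z -> z 0 v = `|z 0 v| * eps f v.
Proof.
move=> sgn /(_ v)[]; case: sgn => -> + z0.
- by rewrite z0// normr0 mul0r.
- by rewrite mul1r => ?; rewrite ger0_norm// mulr1.
- by rewrite mulN1r oppr_ge0 => ?; rewrite ler0_norm// mulrN1 opprK.
Qed.

(* A complete fan, symmetric about the origin, whose cones are indexed by F and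
   in which the vertices v and -v are placed at P v and - P v. The last condition
   says that identifying v and -v leaves a simplicial complex. *)
Record signed_fan : Prop := SignedFan {
  sign_cases : forall f v, [\/ eps f v = 0, eps f v = 1 | eps f v = -1];
  sign_opp : forall f, exists f', forall v, eps f' v = - eps f v;
  signed_surj : forall y, exists f, exists2 z, scone f z & z *m P = y;
  signed_inj : forall f f' z z', scone f z -> scone f' z' ->
    z *m P = z' *m P -> z = z';
  sign_consistent : forall f f' v w, eps f v != 0 -> eps f' v = eps f v ->
    eps f w != 0 -> eps f' w != 0 -> eps f' w = eps f w }.

Hypothesis SF : signed_fan.

Lemma signed_complexP (s : {set 'I_N}) :
  reflect (exists f, s \subset fsupp f) (s \in signed_complex).
Proof. by rewrite inE; apply: (iffP existsP). Qed.

Lemma signed_complex_complex : simplicial_complex signed_complex.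
Proof.
move=> s t /signed_complexP[f sf] ts; apply/signed_complexP; exists f.
exact: fintype.subset_trans ts sf.
Qed.

Lemma sign_sqr f v : eps f v != 0 -> eps f v * eps f v = 1.
Proof. by case: (sign_cases SF f v) => ->; rewrite ?eqxx ?mulr1// mulrNN mulr1. Qed.

Lemma scone_supp f z : scone f z -> supp z \subset fsupp f.
Proof.
move=> zf; apply/suppP => v; rewrite inE negbK => /eqP; exact: (zf v).2.
Qed.

(** The argument of [cone_inj_free] after the signs of f have been removed; [dir] restores them. *)
Lemma signed_free f z : supp z \subset fsupp f -> z *m P = 0 -> z = 0.
Proof.
move=> zf zP0.
pose zs : 'rV[R]_N := \row_v (eps f v * z 0 v).
pose dir (x : 'rV[R]_N) : 'rV[R]_N := \row_v (eps f v * x 0 v).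
have zE : z = dir (pos_part zs) - dir (pos_part (- zs)).
  apply/rowP => v; rewrite !mxE.
  have /= := congr1 (fun x : 'rV_N => x 0 v) (pos_partB zs); rewrite !mxE => e.
  rewrite -mulrBr e; have [ev|ev] := eqVneq (eps f v) 0.
    by rewrite ev mul0r; apply: (suppP _ _ zf); rewrite inE ev eqxx.
  by rewrite mulrA sign_sqr// mul1r.
have dirf x : nneg x -> scone f (dir x).
  move=> x0 v; rewrite mxE; split; last by move=> ->; rewrite mul0r.
  have [->|ev] := eqVneq (eps f v) 0; first by rewrite mul0r.
  by rewrite mulrA sign_sqr// mul1r.
rewrite zE; apply/eqP; rewrite subr_eq0; apply/eqP.
apply: (signed_inj SF (dirf _ (@nneg_pos_part _ _ _)) (dirf _ (@nneg_pos_part _ _ _))).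
by apply/eqP; rewrite -subr_eq0 -mulmxBl -zE zP0.
Qed.

Section Link.
Variables (s : {set 'I_N}) (w : 'I_N).
Hypotheses (sK : s \in signed_complex) (ws : w \in s).

(** Among the two lifts of a simplex containing w, take the one with w positive. By consistency
    every v sharing a simplex with w then has a single sign, so the star of w lifts to an ordinary
    unsigned complex. The value 1 elsewhere is a default. *)
Let sgn v : R :=
  if [pick f | (eps f w == 1) && (eps f v != 0)] is Some f then eps f v else 1.

Let sgnE f v : eps f w = 1 -> eps f v != 0 -> eps f v = sgn v.
Proof.
rewrite /sgn => fw fv; case: pickP => [f' /andP[/eqP f'w f'v]|/(_ f)]; last first.
  by rewrite fw fv eqxx.
by apply: (sign_consistent SF (v := w) (f := f') (f' := f));
  rewrite ?f'w ?fw ?oner_eq0.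
Qed.

Let sgn_sqr v : sgn v * sgn v = 1.
Proof.
by rewrite /sgn; case: pickP => [f /andP[_ fv]|_]; rewrite ?sign_sqr ?mulr1.
Qed.

Let orient (t : {set 'I_N}) : t \in signed_complex -> w \in t ->
  exists2 f, t \subset fsupp f & eps f w = 1.
Proof.
move=> /signed_complexP[f tf] wt; have := fintype.subsetP tf _ wt; rewrite inE.
case: (sign_cases SF f w) => fw; rewrite ?fw ?eqxx// => _; first by exists f.
have [f' f'E] := sign_opp SF f; exists f'; last by rewrite f'E fw opprK.
apply: fintype.subset_trans tf _; apply/fintype.subsetP => v.
by rewrite !inE f'E oppr_eq0.
Qed.

Let D : 'M[R]_N := diag_mx (\row_v sgn v).

Let DE (x : 'rV[R]_N) v : (x *m D) 0 v = x 0 v * sgn v.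
Proof. by rewrite mul_mx_diag !mxE. Qed.

Let DK (x : 'rV[R]_N) : x *m D *m D = x.
Proof. by apply/rowP => v; rewrite !DE -mulrA sgn_sqr mulr1. Qed.

Let Dscone (t : {set 'I_N}) (x : 'rV[R]_N) :
  nneg x -> supp x \subset t -> t \in signed_complex -> w \in t ->
  exists2 f, scone f (x *m D) & eps f w = 1.
Proof.
move=> x0 xt tK wt; have [f tf fw] := orient tK wt; exists f => // v.
rewrite DE; have xf := fintype.subset_trans xt tf.
have [ev|ev] := eqVneq (eps f v) 0.
  by rewrite ev mul0r (suppP _ _ xf) ?mul0r// inE ev eqxx.
rewrite -(sgnE fw ev) mulrCA sign_sqr// mulr1; split=> //.
by move=> e; rewrite e eqxx in ev.
Qed.

Let P' := D *m P.

Let supp_D (x : 'rV[R]_N) : supp (x *m D) \subset supp x.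
Proof. by apply/suppP => v /supp_notin xv; rewrite DE xv mul0r. Qed.

Let U := sel_mx R s *m P'.

Let U_free : row_free U.
Proof.
apply: inj_row_free => u; rewrite /U /P' !mulmxA => e.
have [f sf] := signed_complexP _ sK.
apply: sel_inj; rewrite -[LHS]DK.
rewrite (@signed_free f _ _ e) ?mul0mx//.
by apply: fintype.subset_trans (supp_D _) _; apply: fintype.subset_trans (supp_sel _) sf.
Qed.

(** The projection of R^n along the span of s: the cokernel matrix has the right kernel, and its
    column base makes the map onto. *)
Let Q : 'M[R]_(n, \rank (cokermx U)) := col_base (cokermx U).

Let QP (y : 'rV[R]_n) : reflect (exists2 a, supp a \subset s & y = a *m P') (y *m Q == 0).
Proof.
have -> : (y *m Q == 0) = (y <= U)%MS.
  have -> : (y <= U)%MS = (y *m Q *m row_base (cokermx U) == 0).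
    by rewrite submxE -mulmxA /Q mulmx_base.
  apply/eqP/eqP => [->|e]; first by rewrite mul0mx.
  by apply: (row_free_inj (row_base_free (cokermx U))); rewrite mul0mx.
apply: (iffP submxP) => [[u ->]|[a /sel_surj[u ->] ->]].
- by exists (u *m sel_mx R s); [exact: supp_sel|rewrite /U mulmxA].
- by exists u; rewrite -mulmxA.
Qed.

Let Q_surj (y : 'rV[R]_(\rank (cokermx U))) : exists y', y' *m Q = y.
Proof.
have : (y <= Q)%MS by rewrite submx_full// col_base_full.
by move=> /submxP[y' ->]; exists y'.
Qed.

Let rankQ : \rank (cokermx U) = (n - #|s|)%N.
Proof. by rewrite mxrank_coker (eqP U_free). Qed.

Let link_complex : simplicial_complex (link signed_complex s).
Proof.
move=> t r; rewrite !in_link => /and3P[tK ts tsK] rt; apply/and3P; split.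
- exact: signed_complex_complex tK rt.
- exact: fintype.disjointWl rt ts.
- by apply: signed_complex_complex tsK _; rewrite finset.setSU.
Qed.

(** If x and y agree modulo the span of s, the difference of their images is that of some a
    supported in s. Adding the negative part of a to x and its positive part to y gives two points
    of signed cones with equal image; the original coordinates are then read off outside s. *)
Let link_inj : cone_inj (link signed_complex s) (P' *m Q).
Proof.
move=> x y [x0 xL] [y0 yL]; rewrite (mulmxA x P') (mulmxA y P') => e.
have /QP[a as_ aE] : ((x - y) *m P') *m Q == 0.
  by rewrite !mulmxBl e subrr.
move: xL yL; rewrite !in_link => /and3P[xK xs xsK] /and3P[yK ys ysK].
have nn p (z : 'rV[R]_N) (r : 'rV[R]_N) : nneg z -> supp z = p -> supp r \subset s ->
  nneg (z + pos_part r) /\ supp (z + pos_part r) \subset p :|: s.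
  move=> z0 <- rs; split; first by move=> v; rewrite mxE addr_ge0// nneg_pos_part.
  apply/suppP => v; rewrite finset.in_setU negb_or => /andP[/supp_notin vz vs].
  have /suppP/(_ _ vs) pv := fintype.subset_trans (supp_pos_part r) rs.
  by rewrite mxE vz pv addr0.
have nas : supp (- a) \subset s by rewrite suppN.
have [n1 s1] := nn _ x (- a) x0 erefl nas.
have [n2 s2] := nn _ y a y0 erefl as_.
have wU (t : {set 'I_N}) : w \in (t :|: s)%SET by rewrite finset.in_setU ws orbT.
have [f1 c1 _] := Dscone n1 s1 xsK (wU _).
have [f2 c2 _] := Dscone n2 s2 ysK (wU _).
have main : x + pos_part (- a) = y + pos_part a.
  rewrite -[LHS]DK -[RHS]DK; congr (_ *m D); apply: (signed_inj SF c1 c2).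
  rewrite -2!mulmxA -/P' !mulmxDl; apply/eqP.
  rewrite -subr_eq0 opprD addrACA -!mulmxBl aE -mulmxDl.
  by rewrite -[pos_part (- a) - _]opprB pos_partB subrr mul0mx.
apply/rowP => v; have /rowP/(_ v) := main; rewrite mxE [RHS]mxE.
have [vs|vs] := boolP (v \in s).
  have zero (z : 'rV[R]_N) : [disjoint supp z & s] -> z 0 v = 0.
    move=> zs; apply: supp_notin; apply/negP => vz.
    by have := disjointFr zs vz; rewrite vs.
  by rewrite (zero x)// (zero y).
have pz (r : 'rV[R]_N) : supp r \subset s -> pos_part r 0 v = 0.
  move=> rs; exact: (suppP _ _ (fintype.subset_trans (supp_pos_part r) rs)).
by rewrite !pz ?suppN// !addr0.
Qed.

(* The point y + T u, with u interior to the cone of s, lies for large T in a cone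
   having s as a face: a cone containing it for arbitrarily large T contains u. *)
Let star_absorbs (y : 'rV[R]_n) : exists f z (b : 'rV[R]_N),
  [/\ scone f z, s \subset fsupp f, eps f w = 1, supp b \subset s &
      z *m P = y + b *m P'].
Proof.
pose o : 'rV[R]_N := \row_v (v \in s)%:R.
have os : supp o \subset s by apply/suppP => v /negPf vs; rewrite mxE vs.
have o0 : nneg o by move=> v; rewrite mxE ler0n.
have [fo co fow] := Dscone o0 os sK ws.
have /boolp.choice[ft /boolp.choice[zt ztP]] (T : nat) : exists f z,
    scone f z /\ z *m P = y + T%:R *: (o *m P').
  by have [f [z zf zP]] := signed_surj SF (y + T%:R *: (o *m P')); exists f, z.
(* There are finitely many cones, so one of them contains the moving point for unbounded T. *)
have [f fP] : exists f, forall M : nat, exists2 T, (M < T)%N & ft T = f.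
  apply: contrapT => /forallNP H.
  have /boolp.choice[M MP] f : exists M : nat, forall T, (M < T)%N -> ft T <> f.
    apply: contrapT => /forallNP H'; apply: (H f) => M.
    by have /existsNP[T /not_implyP[MT /contrapT fT]] := H' M; exists T.
  apply: (MP (ft (\max_f M f).+1) (\max_f M f).+1) => //.
  by rewrite ltnS (@leq_bigmax_cond _ xpredT M).
have [T0 _ fT0] := fP 0.
(* The slope of [zt] between T0 and T. It is supported in f and has the same image for every T,
   hence does not depend on T. *)
pose zeta T := (T%:R - T0%:R)^-1 *: (zt T - zt T0).
have czt T : ft T = f -> scone f (zt T) by move=> <-; exact: (ztP T).1.
have zetaP T : (T0 < T)%N -> ft T = f -> zeta T *m P = o *m P'.
  move=> lt fT; rewrite -scalemxAl mulmxBl (ztP T).2 (ztP T0).2.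
  rewrite opprD addrACA subrr add0r -scalerBl scalerA mulVf ?scale1r//.
  by rewrite subr_eq0 eqr_nat gtn_eqF.
have zetas T : (T0 < T)%N -> ft T = f -> supp (zeta T) \subset fsupp f.
  move=> lt fT; apply/suppP => v vf; rewrite !mxE.
  by rewrite !(suppP _ _ (scone_supp (czt _ _)) v vf)// subrr mulr0.
have [T1 T01 fT1] := fP T0.
have zetaC T : (T0 < T)%N -> ft T = f -> zeta T = zeta T1.
  move=> lt fT; apply/eqP; rewrite -subr_eq0; apply/eqP.
  apply: (@signed_free f); last by rewrite mulmxBl !zetaP// subrr.
  apply/suppP => v vf.
  by rewrite mxE [X in _ + X]mxE !(suppP _ _ (zetas _ _ _) v vf)// subrr.
have ztE T : (T0 < T)%N -> ft T = f -> zt T = zt T0 + (T%:R - T0%:R) *: zeta T1.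
  move=> lt fT; have d : T%:R - T0%:R != 0 :> R by rewrite subr_eq0 eqr_nat gtn_eqF.
  by rewrite -(zetaC T lt fT) /zeta scalerA (divff d) scale1r addrC subrK.
have czeta : scone f (zeta T1).
  move=> v; split; last first.
    by move=> fv; apply: (suppP _ _ (zetas _ T01 fT1)); rewrite inE fv eqxx.
  (* A slope of the wrong sign would drive this coordinate of [zt T] out of the cone f for large
     T. *)
  rewrite leNgt; apply/negP => neg.
  have := archi_boundP (normr_ge0 (eps f v * zt T0 0 v / (eps f v * zeta T1 0 v))).
  set m := Num.bound _ => mP.
  have [T Tm fT] := fP (m + T0)%N.
  have lt : (T0 < T)%N by apply: leq_ltn_trans Tm; rewrite leq_addl.
  have ez : zt T 0 v = zt T0 0 v + (T%:R - T0%:R) * zeta T1 0 v.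
    by rewrite (ztE _ lt fT) mxE; congr (_ + _); rewrite mxE.
  have := (czt _ fT v).1; rewrite ez mulrDr mulrCA; set q := eps f v * zeta T1 0 v in neg mP *.
  rewrite leNgt => /negP; apply.
  have le : m%:R <= T%:R - T0%:R :> R.
    by rewrite lerBrDr -natrD ler_nat ltnW.
  rewrite -[X in X + _](divfK (_ : q != 0)) ?lt_eqF//.
  rewrite -mulrDl nmulr_llt0//.
  have := ler_norm (- (eps f v * zt T0 0 v / q)); rewrite normrN; lra.
have oz : o *m D = zeta T1.
  by apply: (signed_inj SF co czeta); rewrite zetaP// -mulmxA.
have sf : s \subset fsupp f.
  apply/fintype.subsetP => v vs; apply: (fintype.subsetP (scone_supp czeta)).
  rewrite -oz inE DE mxE vs mul1r; apply/eqP => e.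
  by have := sgn_sqr v; rewrite e mul0r => /esym/eqP; rewrite oner_eq0.
have fw : eps f w = 1.
  have wf := fintype.subsetP sf _ ws; rewrite inE in wf.
  have fow' : sgn w = 1 by rewrite -(sgnE fow) ?fow ?oner_eq0.
  have := (czeta w).1; rewrite -oz DE mxE ws fow' mul1r mulr1.
  by case: (sign_cases SF f w) => // e; rewrite e ?eqxx// in wf *; rewrite ler0N1.
exists f, (zt T0), (T0%:R *: o); split=> //; first exact: czt.
- by apply/suppP => v vs; rewrite mxE (suppP _ _ os)// mulr0.
- by rewrite (ztP T0).2 -scalemxAl.
Qed.

Let link_surj y : exists2 x, cone (link signed_complex s) x & x *m (P' *m Q) = y.
Proof.
have [y' <-] := Q_surj y; have [f [z [b [zf sf fw bs zP]]]] := star_absorbs y'.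
pose x := z *m D; exists (x *m restr R (~: s)); first split.
- move=> v; rewrite restrE mulr_ge0 ?ler0n// DE.
  have [ev|ev] := eqVneq (eps f v) 0; first by rewrite (zf v).2// mul0r.
  by rewrite -(sgnE fw ev) mulrC; exact: (zf v).1.
- have xf : supp (x *m restr R (~: s)) \subset fsupp f.
    rewrite restr_supp; apply: fintype.subset_trans (subsetIl _ _) _.
    exact: fintype.subset_trans (supp_D _) (scone_supp zf).
  rewrite in_link; apply/and3P; split.
  + by apply/signed_complexP; exists f.
  + rewrite restr_supp disjoint_sym finset.disjoints_subset.
    by rewrite finset.setCI finset.setCK finset.subsetUr.
  + by apply/signed_complexP; exists f; rewrite finset.subUset xf.
(* Both b and the part of x on s lie in the span of s, which Q kills. *)
rewrite (mulmxA _ P'); apply/eqP; rewrite -subr_eq0 -mulmxBl; apply/QP.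
exists (b - x *m restr R s).
  apply/suppP => v vs; rewrite mxE [X in _ + X]mxE restrE (negPf vs) mulr0 subr0.
  exact: (suppP _ _ bs).
have -> : x *m restr R (~: s) = x - x *m restr R s.
  apply/rowP => v; rewrite [RHS]mxE [X in _ + X]mxE !restrE finset.in_setC.
  by case: (v \in s); rewrite /= ?mulr1 ?mulr0 ?subr0 ?subrr.
rewrite !mulmxBl; have -> : x *m P' = z *m P by rewrite /x /P' mulmxA DK.
by rewrite zP addrAC [y' + _]addrC addrK.
Qed.

Lemma link_pl_sphere : pl_sphere R (n - #|s|) (link signed_complex s).
Proof.
by rewrite -rankQ; apply: (fan_pl_sphere link_complex (P := P' *m Q)); split.
Qed.

End Link.

End SignedFans.

(** * A criterion for symmetric fans by two levels of heights *)

(* The fan refines a coarse one, whose maximal cells are indexed by C: [eta c v] is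
   the sign with which v occurs in the cell c, and [cls f] is the cell containing
   the cone f. The coarse fan is induced by the heights mu1, and its subdivision
   inside the cell c by heights mu2 c, which need not agree between cells. *)
Section Criterion.
Variables (R : realType) (N n : nat) (F : finType) (C : Type).
Variables (eps : F -> 'I_N -> R) (cls : F -> C) (eta : C -> 'I_N -> R).
Variables (P : 'M[R]_(N, n)) (lam1 : C -> 'cV[R]_n) (lam2 : F -> 'cV[R]_n).
Variables (mu1 : 'I_N -> R) (mu2 : C -> 'I_N -> R).

Hypothesis eps_cases : forall f v, [\/ eps f v = 0, eps f v = 1 | eps f v = -1].
Hypothesis eta_eps : forall f v, eps f v != 0 -> eta (cls f) v = eps f v.
Hypothesis lam1_leif : forall c v e, e = 1 \/ e = -1 ->
  e * placed P (lam1 c) v <= mu1 v ?= iff (eta c v == e).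
Hypothesis lam2_leif : forall f v, eta (cls f) v != 0 ->
  eta (cls f) v * placed P (lam2 f) v <= mu2 (cls f) v ?= iff (eps f v != 0).
Hypothesis wall : forall f v, eps f v != 0 -> exists f',
  (forall u, u != v -> eps f u != 0 -> eps f' u = eps f u) /\
  (cls f' = cls f /\ eps f' v = 0 \/ eta (cls f') v != eps f v).
Hypothesis cell_face : forall f0 f, exists2 f', cls f' = cls f0 &
  forall v, eps f v != 0 -> eta (cls f0) v = eps f v -> eps f' v != 0.
Hypothesis card_fsupp : forall f, #|fsupp eps f| = n.
Hypothesis sign_opp : forall f, exists f', forall v, eps f' v = - eps f v.
Hypothesis consistent : forall f f' v w, eps f v != 0 -> eps f' v = eps f v ->
    eps f w != 0 -> eps f' w != 0 -> eps f' w = eps f w.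
Variable f0 : F.

Let eps_pm f v : eps f v != 0 -> eps f v = 1 \/ eps f v = -1.
Proof. by case: (eps_cases f v) => ->; rewrite ?eqxx//; [left|right]. Qed.

Let eps_sqr f v : eps f v != 0 -> eps f v * eps f v = 1.
Proof. by move=> /eps_pm[] ->; rewrite ?mulr1// mulrNN mulr1. Qed.

Let placedB g g' v : placed P (g - g') v = placed P g v - placed P g' v.
Proof. by rewrite /placed mulmxBr mxE [X in _ + X]mxE. Qed.

Let mul_placed (z : 'rV[R]_N) g : (z *m P *m g) 0 0 = \sum_v z 0 v * placed P g v.
Proof. by rewrite -mulmxA mxE. Qed.

(** The forms on the two sides of a wall agree on its vertices, where both attain the heights, so
    their difference vanishes on the wall. At v only the form of f attains the height, whence the
    strict sign. *)
Let wall_form f v : eps f v != 0 -> exists f' g,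
  [/\ forall u, u != v -> eps f u != 0 -> placed P g u = 0,
      eps f v * placed P g v < 0 &
      g = lam1 (cls f') - lam1 (cls f) \/
      cls f' = cls f /\ g = lam2 f' - lam2 f].
Proof.
move=> fv; have [f' [f'f f'v]] := wall fv; exists f'.
have [ev|ev] := eqVneq (eta (cls f') v) (eps f v); last first.
  exists (lam1 (cls f') - lam1 (cls f)); split; last by left.
  - move=> u uv fu; have f'u := f'f _ uv fu.
    have /eps_pm pm := fu.
    have e' : eps f u * placed P (lam1 (cls f')) u = mu1 u.
      by apply/eqP; rewrite (lam1_leif (cls f') u pm).2 -f'u eta_eps ?f'u.
    have e : eps f u * placed P (lam1 (cls f)) u = mu1 u.
      by apply/eqP; rewrite (lam1_leif (cls f) u pm).2 eta_eps.
    have : eps f u * placed P (lam1 (cls f') - lam1 (cls f)) u = 0.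
      by rewrite placedB mulrBr e e' subrr.
    by move=> /eqP; rewrite mulf_eq0 (negPf fu) => /eqP.
  - have /eps_pm pm := fv.
    have e : eps f v * placed P (lam1 (cls f)) v = mu1 v.
      by apply/eqP; rewrite (lam1_leif (cls f) v pm).2 eta_eps.
    have l := lam1_leif (cls f') v pm.
    by rewrite placedB mulrBr e subr_lt0 (lt_leif l).
have [cf'|] := f'v; last by rewrite ev eqxx.
case: cf' => cf' f'v0.
exists (lam2 f' - lam2 f); split; last by right.
- move=> u uv fu; have f'u := f'f _ uv fu.
  have e' : eps f u * placed P (lam2 f') u = mu2 (cls f) u.
    have := @lam2_leif f' u; rewrite cf' eta_eps// => /(_ fu) l.
    by apply/eqP; rewrite l.2 f'u.
  have e : eps f u * placed P (lam2 f) u = mu2 (cls f) u.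
    have := @lam2_leif f u; rewrite eta_eps// => /(_ fu) l.
    by apply/eqP; rewrite l.2.
  have : eps f u * placed P (lam2 f' - lam2 f) u = 0.
    by rewrite placedB mulrBr e e' subrr.
  by move=> /eqP; rewrite mulf_eq0 (negPf fu) => /eqP.
- have e : eps f v * placed P (lam2 f) v = mu2 (cls f) v.
    have := @lam2_leif f v; rewrite eta_eps// => /(_ fv) l.
    by apply/eqP; rewrite l.2.
  have := @lam2_leif f' v; rewrite cf' eta_eps// => /(_ fv) l.
  by rewrite placedB mulrBr e subr_lt0 (lt_leif l) f'v0 eqxx.
Qed.

Let wall_value f v (z : 'rV[R]_N) g : supp z \subset fsupp eps f ->
  (forall u, u != v -> eps f u != 0 -> placed P g u = 0) ->
  (z *m P *m g) 0 0 = z 0 v * placed P g v.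
Proof.
move=> zf gu; rewrite mul_placed (bigD1 v)//= big1 ?addr0// => u uv.
have [fu|fu] := eqVneq (eps f u) 0; last by rewrite gu// mulr0.
by rewrite (suppP _ _ zf) ?mul0r// inE fu eqxx.
Qed.

(** The form of the wall opposite v vanishes at the other vertices of f, so it reads off the
    coordinate v. *)
Let free f (z : 'rV[R]_N) : supp z \subset fsupp eps f -> z *m P = 0 -> z = 0.
Proof.
move=> zf zP; apply/rowP => v; rewrite [RHS]mxE.
have [fv|fv] := eqVneq (eps f v) 0; first by apply: (suppP _ _ zf); rewrite inE fv eqxx.
have [f' [g [gu gv _]]] := wall_form fv.
have := wall_value zf gu; rewrite zP mul0mx mxE => /esym/eqP.
rewrite mulf_eq0 => /orP[/eqP//|/eqP e]; by rewrite e mulr0 ltxx in gv.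
Qed.

Let span f (y : 'rV[R]_n) : exists2 z, supp z \subset fsupp eps f & z *m P = y.
Proof.
pose S := sel_mx R (fsupp eps f).
have full : row_full (S *m P).
  have : row_free (S *m P).
    apply: inj_row_free => u; rewrite mulmxA => e.
    by apply: sel_inj; apply: free (supp_sel u) e.
  by rewrite /row_free /row_full => /eqP ->; rewrite card_fsupp.
have : (y <= S *m P)%MS by rewrite submx_full.
by move=> /submxP[u ->]; exists (u *m S); rewrite ?supp_sel// mulmxA.
Qed.

Let surj y : exists f, exists2 z, scone eps f z & z *m P = y.
Proof.
have [f1 f1P] : exists f1, forall f,
    (y *m lam1 (cls f)) 0 0 <= (y *m lam1 (cls f1)) 0 0.
  exists [arg max_(f > f0) (y *m lam1 (cls f)) 0 0]%O.
  by case: Order.TotalTheory.arg_maxP => // f _ H f'; exact: H.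
pose top f := (y *m lam1 (cls f)) 0 0 == (y *m lam1 (cls f1)) 0 0.
have [f /eqP ftop fP] : exists2 f, top f & forall f', top f' ->
    (y *m lam2 f') 0 0 <= (y *m lam2 f) 0 0.
  exists [arg max_(f > f1 | top f) (y *m lam2 f) 0 0]%O;
  by case: Order.TotalTheory.arg_maxP => //; rewrite /top eqxx.
have [z zf zP] := span f y; exists f, z => // v; split; last first.
  by move=> fv; apply: (suppP _ _ zf); rewrite inE fv eqxx.
have [->|fv] := eqVneq (eps f v) 0; first by rewrite mul0r.
rewrite leNgt; apply/negP => neg.
have [f' [g [gu gv gE]]] := wall_form fv.
have : 0 < (y *m g) 0 0.
  rewrite -zP (wall_value zf gu).
  have -> : z 0 v * placed P g v = (eps f v * z 0 v) * (eps f v * placed P g v).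
    by rewrite mulrACA eps_sqr// mul1r.
  by rewrite nmulr_rgt0.
case: gE => [->|[cf' ->]]; rewrite mulmxBr mxE [X in _ + X]mxE subr_gt0 => lt.
- by have := f1P f'; rewrite leNgt -ftop lt.
- by have := fP f'; rewrite /top cf' ftop eqxx leNgt lt => /(_ isT).
Qed.

(** Evaluate g and g' at the common image. By g the height sum of z is at most that of z', by g' the
    reverse; the sums agree, so every vertex used by z' attains its height under g. *)
Let heights f f' z z' g g' (mu : 'I_N -> R) :
  scone eps f z -> scone eps f' z' -> z *m P = z' *m P ->
  (forall v, eps f v != 0 -> eps f v * placed P g v = mu v) ->
  (forall v, eps f' v != 0 -> eps f' v * placed P g' v = mu v) ->
  (forall v, eps f' v != 0 -> eps f' v * placed P g v <= mu v) ->
  (forall v, eps f v != 0 -> eps f v * placed P g' v <= mu v) ->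
  forall v, z' 0 v != 0 -> eps f' v * placed P g v = mu v.
Proof.
move=> zf z'f' e hf hf' lf' lf v z'v.
have val h f1 x : scone eps f1 x ->
    (x *m P *m h) 0 0 = \sum_u `|x 0 u| * (eps f1 u * placed P h u).
  move=> xf; rewrite mul_placed; apply: eq_bigr => u _.
  by rewrite {1}(scone_abs (eps_cases f1 u) xf) mulrA.
have le h f1 x : scone eps f1 x ->
    (forall u, eps f1 u != 0 -> eps f1 u * placed P h u <= mu u) ->
    forall u, `|x 0 u| * (eps f1 u * placed P h u) <= `|x 0 u| * mu u.
  move=> xf hu u; have [xu|xu] := eqVneq (x 0 u) 0.
    by rewrite xu normr0 !mul0r.
  rewrite ler_wpM2l// hu//; apply: contra xu => /eqP fu; apply/eqP.
  exact: (xf u).2.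
have Z : (z *m P *m g) 0 0 = \sum_u `|z 0 u| * mu u.
  rewrite (val _ _ _ zf); apply: eq_bigr => u _.
  have [zu|zu] := eqVneq (z 0 u) 0; first by rewrite zu normr0 !mul0r.
  by rewrite hf//; apply: contra zu => /eqP fu; apply/eqP; exact: (zf u).2.
have Z' : (z' *m P *m g') 0 0 = \sum_u `|z' 0 u| * mu u.
  rewrite (val _ _ _ z'f'); apply: eq_bigr => u _.
  have [zu|zu] := eqVneq (z' 0 u) 0; first by rewrite zu normr0 !mul0r.
  by rewrite hf'//; apply: contra zu => /eqP fu; apply/eqP; exact: (z'f' u).2.
have zz' : \sum_u `|z' 0 u| * mu u <= \sum_u `|z 0 u| * mu u.
  by rewrite -Z' -e (val _ _ _ zf); apply: ler_sum => u _; exact: le.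
have : \sum_u (`|z' 0 u| * mu u - `|z' 0 u| * (eps f' u * placed P g u)) == 0.
  rewrite sumrB -(val _ _ _ z'f') -e Z subr_eq0 eq_le zz' -Z e (val _ _ _ z'f').
  by apply: ler_sum => u _; exact: le.
rewrite psumr_eq0; last by move=> u _; rewrite subr_ge0; exact: le.
move=> /allP/(_ v); rewrite mem_index_enum => /(_ isT) /=.
rewrite -mulrBr mulf_eq0 normr_eq0 (negPf z'v) subr_eq0 => /eqP //.
Qed.

Let scone_neq0 f (z : 'rV[R]_N) v : scone eps f z -> z 0 v != 0 -> eps f v != 0.
Proof. by move=> zf; apply: contra => /eqP fu; apply/eqP; exact: (zf v).2. Qed.

(** Second heights of different cells are not comparable. The coarse heights first show that the
    signed vertices of z' lie in the cell of f; [cell_face] then replaces f' by a cone of that cell,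
    and the second heights put the support of z' into f. *)
Let inj f f' z z' : scone eps f z -> scone eps f' z' -> z *m P = z' *m P -> z = z'.
Proof.
move=> zf z'f' e.
have h1 f1 f2 v : eps f1 v != 0 -> eps f1 v * placed P (lam1 (cls f2)) v <= mu1 v.
  by move=> /eps_pm pm; exact: (lam1_leif (cls f2) v pm).1.
have h1e f1 v : eps f1 v != 0 -> eps f1 v * placed P (lam1 (cls f1)) v = mu1 v.
  move=> fv; have /eps_pm pm := fv; apply/eqP.
  by rewrite (lam1_leif (cls f1) v pm).2 eta_eps.
have eta1 v : z' 0 v != 0 -> eta (cls f) v = eps f' v.
  move=> z'v; have f'v := scone_neq0 z'f' z'v; have /eps_pm pm := f'v.
  apply/eqP; rewrite -(lam1_leif (cls f) v pm).2; apply/eqP.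
  by apply: (heights zf z'f' e (g := lam1 (cls f)) (g' := lam1 (cls f')) (mu := mu1)) => //;
    move=> u; [exact: h1e|exact: h1e|exact: h1|exact: h1].
have [f2 cf2 f2P] := cell_face f f'.
have z'f2 v : z' 0 v != 0 -> eps f2 v = eps f' v.
  move=> z'v; have f'v := scone_neq0 z'f' z'v.
  by rewrite -eta_eps ?cf2 ?eta1//; apply: f2P => //; exact: eta1.
have {z'f2} c2 : scone eps f2 z'.
  move=> v; have [->|z'v] := eqVneq (z' 0 v) 0; first by rewrite mulr0.
  by rewrite z'f2//; exact: z'f'.
have h2 f3 f4 : cls f3 = cls f -> cls f4 = cls f -> forall v, eps f3 v != 0 ->
    eps f3 v * placed P (lam2 f4) v <= mu2 (cls f) v ?= iff (eps f4 v != 0).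
  move=> c3 c4 v f3v; have := @lam2_leif f4 v.
  by rewrite c4 -c3 (eta_eps f3v) => /(_ f3v).
have supp' : supp z' \subset fsupp eps f.
  apply/fintype.subsetP => v; rewrite !inE => z'v.
  have f2v := scone_neq0 c2 z'v.
  rewrite -(h2 f2 f cf2 erefl v f2v).2; apply/eqP.
  apply: (heights zf c2 e (g := lam2 f) (g' := lam2 f2) (mu := mu2 (cls f))) => // u fu.
  - by apply/eqP; rewrite (h2 f f erefl erefl u fu).2.
  - by apply/eqP; rewrite (h2 f2 f2 cf2 cf2 u fu).2.
  - exact: (h2 f2 f cf2 erefl u fu).1.
  - exact: (h2 f f2 erefl cf2 u fu).1.
apply/eqP; rewrite -subr_eq0; apply/eqP; apply: (@free f).
  apply/suppP => v vf; rewrite mxE [X in _ + X]mxE (suppP _ _ supp')//.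
  by rewrite (zf v).2 ?subrr//; apply/eqP; rewrite inE negbK in vf.
by rewrite mulmxBl e subrr.
Qed.

Lemma signed_fanP : signed_fan eps P.
Proof. by split. Qed.

End Criterion.

(** * Continuity on finite closed covers and of linear maps *)

Section Continuity.
Local Open Scope classical_set_scope.
Local Open Scope ring_scope.

(** Closed pieces that miss x also miss a neighbourhood of x, so only the finitely many pieces
    through x matter. *)
Lemma near_closed_cover (S T : topologicalType) (A : set S) (f : S -> T)
    (I : finType) (D : I -> set S) :
  (forall i, closed (D i)) ->
  (forall x, A x -> exists i, D i x) ->
  (forall i x U, A x -> D i x -> nbhs (f x) U ->
     \forall y \near x, A y -> D i y -> U (f y)) ->
  forall x U, A x -> nbhs (f x) U -> \forall y \near x, A y -> U (f y).
Proof.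
move=> Dc AD fU x U Ax Ufx.
have : \forall y \near x, forall i, A y -> D i y -> U (f y).
  apply: filter_forall => i; case: (pselect (D i x)) => [Dx|nDx]; first exact: fU.
  have : nbhs x (~` D i).
    by apply: open_nbhs_nbhs; split=> //; apply: closed_openC.
  by apply: filterS => y nDy _ /nDy.
by apply: filterS => y H Ay; have [i Dy] := AD _ Ay; exact: H Ay Dy.
Qed.

Lemma closed_forall (T : topologicalType) (I : Type) (A : I -> set T) :
  (forall i, closed (A i)) -> closed [set x | forall i, A i x].
Proof.
move=> Ac; have -> : [set x | forall i, A i x] =
    (\bigcap_(i in [set: I]) A i).
  by apply/seteqP; split => x Hx i //; exact: Hx.
by apply: closed_bigI => i _; exact: Ac.
Qed.

Lemma closed_implies (T : topologicalType) (Q : Prop) (A : set T) :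
  closed A -> closed [set x | Q -> A x].
Proof.
move=> Ac; case: (pselect Q) => [q|nq].
- by rewrite (_ : mkset _ = A)//; apply/seteqP; split => x //= /(_ q).
- by rewrite (_ : mkset _ = setT) ?closedT//; apply/seteqP; split => x // _ /nq.
Qed.

Variable R : realType.

Lemma cvg_mx (T : Type) (F : set_system T) (m n : nat) (f : T -> 'M[R]_(m, n))
    (l : 'M[R]_(m, n)) : Filter F ->
  (forall i j, f x i j @[x --> F] --> l i j) -> f @ F --> l.
Proof.
move=> FF H A [P lP PA]; rewrite nbhs_simpl /=.
have : \forall x \near F, forall i j, P i j (f x i j).
  by apply: filter_forall => i; apply: filter_forall => j; exact: H (lP i j).
by apply: filterS => x Px; apply: PA => i j; exact: Px.
Qed.

Lemma mulmx_coord_continuous (n m : nat) (M : 'M[R]_(n, m)) j :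
  continuous (fun x : 'rV[R]_n => (x *m M) 0 j).
Proof.
have -> : (fun x : 'rV[R]_n => (x *m M) 0 j) = fun x => \sum_v x 0 v * M v j.
  by apply/funext => x; rewrite mxE.
apply: continuous_big => [x|v _ x].
  exact: add_continuous.
have c1 : {for x, continuous (fun y : 'rV[R]_n => (y 0 v : R))} by exact: coord_continuous.
have c2 : {for x, continuous (fun y : 'rV[R]_n => M v j)} by exact: cst_continuous.
exact: (continuousM c1 c2).
Qed.

Lemma mulmx_continuous (n m : nat) (M : 'M[R]_(n, m)) :
  continuous (fun x : 'rV[R]_n => x *m M).
Proof.
by move=> x; apply: (@cvg_mx _ (nbhs x) _ _ _ _ (nbhs_filter x)) => i j;
  rewrite (ord1 i); exact: mulmx_coord_continuous.
Qed.

Lemma closed_mulmx_ge0 (n m : nat) (M : 'M[R]_(n, m)) j (a : R) :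
  closed [set x : 'rV[R]_n | 0 <= a * (x *m M) 0 j].
Proof.
have c : continuous (fun x : 'rV[R]_n => a * (x *m M) 0 j).
  move=> x.
  exact: (continuousM (s := fun=> a) (@cst_continuous _ _ a x) (@mulmx_coord_continuous _ _ M j x)).
exact: ((continuous_closedP _).1 c _ (@closed_ge R 0)).
Qed.

Lemma closed_mulmx_eq0 (n m : nat) (M : 'M[R]_(n, m)) j :
  closed [set x : 'rV[R]_n | (x *m M) 0 j = 0].
Proof.
exact: ((continuous_closedP _).1 (@mulmx_coord_continuous _ _ M j) _ (@closed_eq R 0)).
Qed.

End Continuity.

(** * Homogeneous coordinates *)

Section HomogeneousCoordinates.
Local Open Scope classical_set_scope.
Local Open Scope ring_scope.
Local Open Scope quotient_scope.
Variables (R : realType) (k : nat).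
Implicit Types (p q : RP R k) (x y : 'rV[R]_k.+1).

Lemma nzvec_ex x : x != 0 -> exists y : nzvec R k, set_val y = x.
Proof.
move=> x0; have xA : x \in [set x : 'rV[R]_k.+1 | x != 0] by apply/mem_set.
by exists (exist _ x xA).
Qed.

Lemma nzvec_neq0 (y : nzvec R k) : set_val y != 0.
Proof. by case: y => y yP; rewrite set_valE /=; exact: set_mem yP. Qed.

Lemma hcoords_neq0 p x : hcoords p x -> x != 0.
Proof. by move=> [y <- _]; exact: nzvec_neq0. Qed.

Lemma hcoords_ex p : exists x, hcoords p x.
Proof. by exists (set_val (repr p)), (repr p) => //; rewrite reprK. Qed.

Lemma pi_RP_eq (u v : nzvec R k) :
  \pi_(RP R k) u = \pi_(RP R k) v <->
  exists2 a : R, a != 0 & set_val u = a *: set_val v.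
Proof.
have E : reflect (\pi_(RP R k) u = \pi_(RP R k) v) (proportional u v).
  exact: (@eqmodP _ (proportional_equiv R k)).
by split=> [/E/asboolP|H]//; apply/E/asboolP.
Qed.

Lemma hcoords_prop p x y : hcoords p x -> hcoords p y ->
  exists2 a, a != 0 & x = a *: y.
Proof.
by move=> [u <- ->] [v <- /pi_RP_eq].
Qed.

Lemma hcoords_scale p x a : a != 0 -> hcoords p x -> hcoords p (a *: x).
Proof.
move=> a0 px; have [u uE] := nzvec_ex (hcoords_neq0 px).
have [|w wE] := @nzvec_ex (a *: x).
  by rewrite scaler_eq0 negb_or a0 (hcoords_neq0 px).
exists w => //; move: px => [y yx ->]; apply/pi_RP_eq.
by exists a^-1; rewrite ?invr_eq0// wE yx scalerA mulVf// scale1r.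
Qed.

Lemma hcoords_inj p q x : hcoords p x -> hcoords q x -> p = q.
Proof.
move=> [u ux ->] [v vx ->]; apply/pi_RP_eq.
by exists 1; rewrite ?oner_eq0// scale1r ux vx.
Qed.

End HomogeneousCoordinates.

(** * The homeomorphism from the quotient complex onto projective space *)

Section ProjectiveTriangulation.
Local Open Scope classical_set_scope.
Local Open Scope ring_scope.
Local Open Scope quotient_scope.
Variables (R : realType) (k N : nat) (F : finType) (eps : F -> 'I_N -> R).
Variable P : 'M[R]_(N, k.+1).
Hypothesis SF : signed_fan eps P.

Let K := signed_complex eps.
Let Kc : simplicial_complex K := @signed_complex_complex R N F eps.

Definition signed_mx f : 'M[R]_N := diag_mx (\row_v eps f v).

Definition lift_mx f : 'M[R]_(N, k.+1) := signed_mx f *m P.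

Lemma signed_mxE f (x : 'rV[R]_N) v : (x *m signed_mx f) 0 v = x 0 v * eps f v.
Proof. by rewrite mul_mx_diag !mxE. Qed.

Lemma lift_mxE f (x : 'rV[R]_N) l :
  (x *m lift_mx f) 0 l = \sum_v x 0 v * (eps f v * P v l).
Proof.
rewrite /lift_mx mulmxA mxE; apply: eq_bigr => v _.
by rewrite signed_mxE mulrA.
Qed.

Lemma scone_signed_mx f x : nneg x -> supp x \subset fsupp eps f ->
  scone eps f (x *m signed_mx f).
Proof.
move=> x0 xf v; rewrite signed_mxE; split; last by move=> ->; rewrite mulr0.
rewrite mulrCA mulr_ge0//; case: (sign_cases SF f v) => ->;
  by rewrite ?mulr0 ?mulr1 ?mulrNN ?mulr1.
Qed.

Lemma signed_mxK f (x : 'rV[R]_N) : supp x \subset fsupp eps f ->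
  x *m signed_mx f *m signed_mx f = x.
Proof.
move=> /suppP xf; apply/rowP => v; rewrite !signed_mxE.
have [fv|fv] := eqVneq (eps f v) 0; first by rewrite xf ?mul0r// inE fv eqxx.
by rewrite -mulrA (sign_sqr SF) ?mulr1.
Qed.

Lemma lift_neq0 f x : nneg x -> x != 0 -> supp x \subset fsupp eps f ->
  x *m lift_mx f != 0.
Proof.
move=> x0 xn0 xf; apply: contra xn0 => /eqP; rewrite /lift_mx mulmxA => e.
have s0 : scone eps f 0 by move=> v; rewrite mxE mulr0.
have := signed_inj SF (scone_signed_mx x0 xf) s0; rewrite e mul0mx => /(_ erefl) e'.
by rewrite -(signed_mxK xf) e' mul0mx.
Qed.

Lemma lift_mx_opp f f' : (forall v, eps f' v = - eps f v) ->
  forall x : 'rV[R]_N, x *m lift_mx f' = - (x *m lift_mx f).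
Proof.
move=> f'E x; apply/rowP => l; rewrite lift_mxE mxE lift_mxE -sumrN.
by apply: eq_bigr => v _; rewrite f'E mulNr mulrN.
Qed.

(** By consistency the signs of f and f' on the support of x agree at all vertices or are opposite
    at all of them, so the two lifts define the same projective point. *)
Lemma lift_mx_indep f f' (x : 'rV[R]_N) : x != 0 ->
  supp x \subset fsupp eps f -> supp x \subset fsupp eps f' ->
  exists2 a : R, `|a| = 1 & x *m lift_mx f' = a *: (x *m lift_mx f).
Proof.
move=> xn0 xf xf'.
have [v xv] : exists v, x 0 v != 0.
  apply: contrapT => /forallNP H; case/eqP: xn0; apply/rowP => v; rewrite mxE.
  by apply/eqP; apply: contraT => /H.
have nz f1 w : supp x \subset fsupp eps f1 -> x 0 w != 0 -> eps f1 w != 0.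
  by move=> /fintype.subsetP/(_ w); rewrite !inE => H /H.
have same f1 : supp x \subset fsupp eps f1 -> eps f1 v = eps f v ->
    x *m lift_mx f1 = x *m lift_mx f.
  move=> xf1 e; apply/rowP => l; rewrite !lift_mxE; apply: eq_bigr => w _.
  have [->|xw] := eqVneq (x 0 w) 0; first by rewrite !mul0r.
  congr (_ * (_ * _)).
  by apply: (sign_consistent SF (f := f) (f' := f1) (v := v)); rewrite ?nz.
have [e|ne] := eqVneq (eps f' v) (eps f v).
  by exists 1; rewrite ?normr1// scale1r same.
have [f2 f2E] := sign_opp SF f'.
exists (-1); first by rewrite normrN1.
rewrite scaleN1r -(same f2).
- by rewrite (lift_mx_opp f2E) opprK.
- apply: fintype.subset_trans xf' _; apply/fintype.subsetP => u.
  by rewrite !inE f2E oppr_eq0.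
- rewrite f2E; have := nz _ _ xf xv; have := nz _ _ xf' xv.
  move: ne; case: (sign_cases SF f' v) => ->; case: (sign_cases SF f v) => ->;
    by rewrite ?eqxx ?opprK.
Qed.

Lemma realization_neq0 x : realization R K x -> x != 0.
Proof.
move=> /(realizationE _ Kc)[_]; apply: contra_eq_neq => ->.
by rewrite big1 => [|v _]; rewrite ?mxE// eq_sym oner_eq0.
Qed.

Lemma realization_face x : realization R K x ->
  exists f, supp x \subset fsupp eps f.
Proof. by move=> /(realizationE _ Kc)[[_ /signed_complexP]]. Qed.

Definition lifts_to (h : 'rV[R]_N -> RP R k) :=
  forall x f, realization R K x -> supp x \subset fsupp eps f ->
    hcoords (h x) (x *m lift_mx f).

Lemma lifts_to_ex : exists h, lifts_to h.
Proof.
suff /boolp.choice[h hP] : forall x, exists p : RP R k, forall f,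
    realization R K x -> supp x \subset fsupp eps f -> hcoords p (x *m lift_mx f).
  by exists h.
move=> x; case: (pselect (realization R K x)) => [Kx|nKx]; last first.
  (* Outside the realization the value is arbitrary. *)
  have [|y yE] := @nzvec_ex R k (const_mx 1).
    by apply/eqP => /rowP/(_ ord0)/eqP; rewrite !mxE oner_eq0.
  by exists (\pi_(RP R k) y) => f.
have [f xf] := realization_face Kx; have xn0 := realization_neq0 Kx.
have /(realizationE _ Kc)[[x0 _] _] := Kx.
have [y yE] := nzvec_ex (lift_neq0 x0 xn0 xf).
have py : hcoords (\pi_(RP R k) y) (x *m lift_mx f) by exists y.
exists (\pi_(RP R k) y) => f' _ xf'.
have [a a1 ->] := lift_mx_indep xn0 xf xf'.
by apply: hcoords_scale => //; rewrite -normr_gt0 a1.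
Qed.

Section WithMap.
Variable h : 'rV[R]_N -> RP R k.
Hypothesis hL : lifts_to h.

Lemma lifts_to_inj x x' : realization R K x -> realization R K x' -> h x = h x' ->
  x = x'.
Proof.
move=> Kx Kx' hxx'.
have [f xf] := realization_face Kx; have [f' xf'] := realization_face Kx'.
have /(realizationE _ Kc)[[x0 _] x1] := Kx.
have /(realizationE _ Kc)[[x'0 _] x'1] := Kx'.
have := hL Kx' xf'; rewrite -hxx' => hx'.
have [a a0 e] := hcoords_prop (hL Kx xf) hx'.
(* Passing to the opposite of f' changes the sign of a. With a positive, both sides lie in signed
   cones and the fan property applies; the coordinate sums then give a = 1. *)
wlog a_gt0 : f' xf' hx' a a0 e / 0 < a => [wl|].
  have [a_gt0|] := ltP 0 a; first exact: (wl f' xf' hx' a a0 e a_gt0).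
  rewrite le_eqVlt (negPf a0) /= => a_lt0.
  have [f2 f2E] := sign_opp SF f'.
  have e2 := lift_mx_opp f2E x'.
  apply: (wl f2 _ _ (- a)).
  - apply: fintype.subset_trans xf' _; apply/fintype.subsetP => u.
    by rewrite !inE f2E oppr_eq0.
  - by rewrite e2 -scaleN1r; apply: hcoords_scale => //; rewrite oppr_eq0 oner_eq0.
  - by rewrite oppr_eq0.
  - by rewrite e2 scalerN scaleNr opprK.
  - by rewrite oppr_gt0.
have ax'0 : nneg (a *: x') by move=> v; rewrite mxE mulr_ge0// ltW.
have ax'f' : supp (a *: x') \subset fsupp eps f'.
  by apply/suppP => v vf; rewrite mxE (suppP _ _ xf')// mulr0.
have c1 := scone_signed_mx x0 xf; have c2 := scone_signed_mx ax'0 ax'f'.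
have := signed_inj SF c1 c2; rewrite -!mulmxA -/(lift_mx f) -/(lift_mx f').
rewrite -scalemxAl => /(_ e) E.
have xE v : x 0 v = a * x' 0 v.
  have /rowP/(_ v) := E; rewrite !signed_mxE [(a *: x') 0 v]mxE => Ev.
  have nrm (y : 'rV[R]_N) f1 : nneg y -> supp y \subset fsupp eps f1 ->
      `|y 0 v * eps f1 v| = y 0 v.
    move=> y0 /suppP yf; rewrite normrM (ger0_norm (y0 v)).
    have := yf v; rewrite inE; case: (sign_cases SF f1 v) => ->.
    - by rewrite eqxx => ->; rewrite ?mul0r.
    - by rewrite normr1 mulr1.
    - by rewrite normrN1 mulr1.
  have := nrm _ _ x0 xf; rewrite Ev; have := nrm _ _ ax'0 ax'f'.
  by rewrite mxE => -> <-.
have a1 : a = 1.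
  have : \sum_v x 0 v = a * \sum_v x' 0 v.
    by rewrite mulr_sumr; apply: eq_bigr => v _; rewrite xE.
  by rewrite x1 x'1 mulr1.
by apply/rowP => v; rewrite xE a1 mul1r.
Qed.

(** Barycentric coordinates in the quotient: v and -v have become one vertex, so signs are
    dropped. *)
Definition abs_row (z : 'rV[R]_N) : 'rV[R]_N :=
  \row_v (`|z 0 v| / \sum_u `|z 0 u|).

Lemma abs_row_lift f z p : scone eps f z -> z != 0 -> hcoords p (z *m P) ->
  realization R K (abs_row z) /\ h (abs_row z) = p.
Proof.
move=> zf zn0 pz.
have s0 : 0 < \sum_u `|z 0 u|.
  rewrite lt_neqAle sumr_ge0// andbT eq_sym; apply: contra zn0.
  rewrite psumr_eq0// => /allP H; apply/eqP/rowP => v; rewrite mxE.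
  by apply/eqP; rewrite -normr_eq0; apply: H; rewrite mem_index_enum.
have af : supp (abs_row z) \subset fsupp eps f.
  apply/suppP => v vf; rewrite mxE (suppP _ _ (scone_supp zf))//.
  by rewrite normr0 mul0r.
have Ka : realization R K (abs_row z).
  apply/(realizationE _ Kc); split; first split.
  - by move=> v; rewrite mxE divr_ge0// ltW.
  - by apply/signed_complexP; exists f.
  - under eq_bigr do rewrite mxE.
    by rewrite -mulr_suml divff// gt_eqF.
split=> //; apply: hcoords_inj (hL Ka af) _.
have -> : abs_row z *m lift_mx f = (\sum_u `|z 0 u|)^-1 *: (z *m P).
  rewrite /lift_mx mulmxA scalemxAl; congr (_ *m P); apply/rowP => v.
  by rewrite signed_mxE !mxE mulrAC -(scone_abs (sign_cases SF f v) zf) mulrC.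
by apply: hcoords_scale => //; rewrite invr_eq0 gt_eqF.
Qed.

Lemma lifts_to_surj p : exists2 x, realization R K x & h x = p.
Proof.
have [y py] := hcoords_ex p; have [f [z zf zP]] := signed_surj SF y.
have zn0 : z != 0.
  by apply: contra (hcoords_neq0 py) => /eqP z0; rewrite -zP z0 mul0mx.
have [Ka ha] : realization R K (abs_row z) /\ h (abs_row z) = p.
  by apply: abs_row_lift zf zn0 _; rewrite zP.
by exists (abs_row z).
Qed.

Lemma lifts_to_continuous : {within realization R K, continuous h}.
Proof.
apply/subspace_continuousP => x0 Kx0 U0 Ux0.
suff H : forall x U, realization R K x -> nbhs (h x) U ->
  \forall y \near x, realization R K y -> U (h y) by exact: H Kx0 Ux0.
apply: (@near_closed_cover _ _ (realization R K) h F
  (fun f => [set x : 'rV[R]_N | forall v, eps f v = 0 -> x 0 v = 0])).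
- move=> f; apply: (@closed_forall _ _
    (fun v => [set x : 'rV[R]_N | eps f v = 0 -> x 0 v = 0])) => v.
  apply: closed_implies.
  rewrite (_ : (fun _ => _) = [set x : 'rV[R]_N | (x *m 1%:M) 0 v = 0]).
    exact: closed_mulmx_eq0.
  by apply/seteqP; split => x /=; rewrite mulmx1.
- move=> x /realization_face[f /suppP xf]; exists f => v fv.
  by apply: xf; rewrite inE fv eqxx.
- move=> f x U Kx xf; have fx (y : 'rV[R]_N) : (forall v, eps f v = 0 -> y 0 v = 0) ->
      supp y \subset fsupp eps f.
    by move=> yf; apply/suppP => v; rewrite inE negbK => /eqP; exact: yf.
  have [w wE ->] := hL Kx (fx _ xf).
  move=> /(@pi_continuous _ (RP R k) w) H.
  have : nbhs w (\pi_(RP R k) @^-1` U) := H.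
  rewrite nbhsE; case=> O Oo OU; case: Oo; case=> W Wo WO Ow {H}.
  have : nbhs (x *m lift_mx f) W.
    by apply: open_nbhs_nbhs; split=> //; rewrite -wE; move: Ow; rewrite -WO.
  move=> /(@mulmx_continuous R _ _ (lift_mx f) x) H.
  have : nbhs x ((fun y => y *m lift_mx f) @^-1` W) := H.
  apply: filterS => y Wy Ky yf.
  have [w' w'E ->] := hL Ky (fx _ yf); apply: OU; rewrite -WO /=.
  by rewrite w'E.
Qed.

Lemma lifts_to_homeomorphism : homeomorphism (realization R K) [set: RP R k] h.
Proof.
split; first exact: lifts_to_continuous.
have /boolp.choice[g gP] p : exists x, realization R K x /\ h x = p.
  by have [x Kx hx] := lifts_to_surj p; exists x.
exists g; split; last first.
- by move=> p _; exact: gP.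
- by move=> x Kx; split=> //; have [Kg hg] := gP (h x); exact: lifts_to_inj.
(* By the quotient topology, continuity of the inverse may be tested on nonzero vectors. *)
apply: continuous_subspaceT; apply/quotient_continuous.
have /boolp.choice[Q QP] f : exists Q : 'M[R]_(k.+1, N),
    forall z, supp z \subset fsupp eps f -> z *m P *m Q = z.
  have [|Q HQ] := @mulmx_factor R _ _ _ (restr R (fsupp eps f) *m P) (restr R (fsupp eps f)).
    move=> u; rewrite mulmxA => e; apply: (signed_free SF (f := f) _ e).
    by rewrite restr_supp finset.subsetIr.
  exists Q => z zf.
  by rewrite -{1}(restr_id zf) -2!mulmxA (mulmxA _ P) HQ restr_id.
have zE f (z : 'rV[R]_N) (y : nzvec R k) : scone eps f z -> z *m P = set_val y ->
    g (\pi_(RP R k) y) = abs_row z.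
  move=> zf zP; have zn0 : z != 0.
    by apply: contra (nzvec_neq0 y) => /eqP z0; rewrite -zP z0 mul0mx.
  have [|Ka ha] := @abs_row_lift f z (\pi_(RP R k) y) zf zn0; first by exists y.
  have [Kg hg] := gP (\pi_(RP R k) y).
  by apply: lifts_to_inj; rewrite ?hg.
(* The cones of the fan, written with the linear inverse [Q f] so that they are visibly closed; on
   each of them the inverse is given by [abs_row]. *)
pose D f := [set y : nzvec R k | scone eps f (set_val y *m Q f) /\
  set_val y *m Q f *m P = set_val y].
have DU f y : D f y -> g (\pi_(RP R k) y) = abs_row (set_val y *m Q f).
  by move=> [c e]; exact: zE c e.
move=> y U Ug; rewrite near_simpl.
have := @near_closed_cover _ _ setT (g \o \pi_(RP R k)) F D _ _ _ y U I Ug.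
move=> H; have {H} : \forall y0 \near y, setT y0 -> U ((g \o \pi_(RP R k)) y0).
  apply: H => {y U Ug}.
  - move=> f.
    pose E := [set y : 'rV[R]_k.+1 | forall v, 0 <= eps f v * (y *m Q f) 0 v] `&`
      ([set y : 'rV[R]_k.+1 | forall v, eps f v = 0 -> (y *m Q f) 0 v = 0] `&`
       [set y : 'rV[R]_k.+1 | forall l, (y *m (Q f *m P - 1%:M)) 0 l = 0]).
    have -> : D f = set_val @^-1` E.
      apply/seteqP; split => y /=.
      + move=> [c e]; split; first by move=> v; exact: (c v).1.
        split=> /=; first by move=> v; exact: (c v).2.
        by move=> l; rewrite mulmxBr mulmx1 mulmxA e subrr mxE.
      + move=> [c1 [c2 c3]]; split; first by move=> v; split; [exact: c1|exact: c2].
        apply/rowP => l; have := c3 l; rewrite mulmxBr mulmx1 mulmxA mxE.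
        by rewrite [X in _ + X]mxE => /eqP; rewrite subr_eq0 => /eqP.
    apply: (continuous_closedP _).1; first exact: initial_continuous.
    apply: closedI; last apply: closedI.
    + by apply: closed_forall => v; exact: closed_mulmx_ge0.
    + apply: (@closed_forall _ _ (fun v =>
        [set y : 'rV[R]_k.+1 | eps f v = 0 -> (y *m Q f) 0 v = 0])) => v.
      by apply: closed_implies; exact: closed_mulmx_eq0.
    + by apply: closed_forall => l; exact: closed_mulmx_eq0.
  - move=> y _; have [f [z zf zP]] := signed_surj SF (set_val y); exists f.
    by rewrite /D /= -zP QP ?scone_supp.
  - move=> f y U _ Dy; rewrite /= (DU _ _ Dy) => Uy.
    have cont : abs_row (set_val y' *m Q f) @[y' --> y] --> abs_row (set_val y *m Q f).
      have cz v : (set_val y' *m Q f) 0 v @[y' --> y] --> (set_val y *m Q f) 0 v.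
        apply: (@continuous_comp _ _ _ (set_val : nzvec R k -> 'rV[R]_k.+1)
           (fun w => (w *m Q f) 0 v)).
          exact: initial_continuous.
        exact: mulmx_coord_continuous.
      apply: (@cvg_mx R _ (nbhs y) _ _ _ _ (nbhs_filter y)) => i v; rewrite mxE.
      under eq_fun do rewrite mxE.
      apply: (@cvgM R _ (nbhs y) (nbhs_filter y)); first exact: cvg_norm.
      apply: (@cvgV R _ (nbhs y) (nbhs_filter y)).
        apply: contra (nzvec_neq0 y); rewrite psumr_eq0// => /allP z0.
        have [_ <-] := Dy; apply/eqP; have -> : set_val y *m Q f = 0.
          apply/rowP => u; rewrite [RHS]mxE; apply/eqP; rewrite -normr_eq0.
          by apply: z0; rewrite mem_index_enum.
        by rewrite mul0mx.
      by apply: cvg_big => [|u _]; [exact: add_continuous|exact: cvg_norm].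
    have : nbhs y ((fun y' => abs_row (set_val y' *m Q f)) @^-1` U) := cont _ Uy.
    apply: filterS => y' Uy' _ Dy' /=.
    by rewrite (DU _ _ Dy').
by apply: filterS => y0; apply.
Qed.

End WithMap.
End ProjectiveTriangulation.

(** * From a symmetric fan on the cube to a nice triangulation *)

Lemma convex_extreme (R : realType) (N : nat) (x q : 'I_N -> R) (e : R) :
  (forall v, 0 <= x v) -> \sum_v x v = 1 -> (forall v, x v != 0 -> q v <= e) ->
  \sum_v x v * q v = e -> forall v, x v != 0 -> q v = e.
Proof.
move=> x0 x1 qe xq v xv.
have le u : 0 <= x u * (e - q u).
  have [->|xu] := eqVneq (x u) 0; first by rewrite mul0r.
  by rewrite mulr_ge0// subr_ge0 qe.
have : \sum_u x u * (e - q u) == 0.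
  under eq_bigr do rewrite mulrBr.
  by rewrite sumrB -mulr_suml x1 mul1r xq subrr.
rewrite psumr_eq0// => /allP/(_ v); rewrite mem_index_enum => /(_ isT) /=.
by rewrite mulf_eq0 (negPf xv) subr_eq0 => /eqP.
Qed.

Lemma pyramid_ineq (R : realType) (k : nat) (i j : 'I_k.+1) (e : bool)
    (y : 'rV[R]_k.+1) :
  j != i -> y 0 i = 1 -> (-1) ^+ e * y 0 j <= 1 ->
  (forall l, l != i -> `|y 0 l| <= (-1) ^+ e * y 0 j) -> pyramid i j e y.
Proof.
move=> ji yi t1 yl; set t := (-1) ^+ e * y 0 j in t1 yl.
have t0 : 0 <= t by apply: le_trans (yl _ ji).
have sgn2 : (-1) ^+ e * (-1) ^+ e = 1 :> R by rewrite -expr2 sqrr_sign.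
have yj : y 0 j = t * (-1) ^+ e by rewrite /t mulrAC sgn2 mul1r.
have [tz|tn0] := eqVneq t 0.
  (* For t = 0 the point is the apex, and any point of the base will do. *)
  exists 0, (\row_l (if l == i then 1 else if l == j then (-1) ^+ e else 0)).
  split; first by rewrite lexx ler01.
  - split; rewrite ?mxE ?eqxx// ?(negPf ji)// => l; rewrite mxE.
    case: ifP => _; first by rewrite normr1.
    by case: ifP => _; rewrite ?normrX ?normrN1 ?expr1n// normr0 ler01.
  - rewrite subr0 scale1r scale0r addr0; apply/rowP => l; rewrite mxE eqxx /=.
    have [->|li] := eqVneq l i; first by rewrite yi.
    by apply/eqP; rewrite -normr_le0 -tz yl.
have t_gt0 : 0 < t by rewrite lt_neqAle eq_sym tn0.
exists t, (delta_mx 0 i + t^-1 *: (y - delta_mx 0 i)).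
split; first by rewrite t0.
- split.
  + by rewrite !mxE !eqxx yi subrr mulr0 addr0.
  + by rewrite !mxE !eqxx (negPf ji) subr0 add0r yj mulrA mulVf// mul1r.
  + move=> l; rewrite !mxE eqxx /=; have [->|li] := eqVneq l i.
      by rewrite yi subrr mulr0 addr0 normr1.
    rewrite subr0 add0r normrM gtr0_norm ?invr_gt0//.
    by rewrite mulrC ler_pdivrMr// mul1r yl.
- rewrite scalerDr scalerA divff// scale1r addrA -scalerDl subrK scale1r.
  by rewrite addrC subrK.
Qed.

Section NiceTriangulation.
Local Open Scope classical_set_scope.
Local Open Scope ring_scope.
Variables (R : realType) (k N : nat) (F : finType) (eps : F -> 'I_N -> R).
Variable P : 'M[R]_(N, k.+1).
Hypothesis SF : signed_fan eps P.

Let K := signed_complex eps.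
Let Kc : simplicial_complex K := @signed_complex_complex R N F eps.

Hypothesis card_fsupp : forall f, #|fsupp eps f| = k.+1.
Hypothesis P_le1 : forall v l, `|P v l| <= 1.
(** Pyramids lie in x_i = 1 only, so a cone whose lift has x_i = -1 is treated through another lift
    [f'], in the application the antipodal one. *)
Hypothesis in_pyramid : forall f, exists f' i j (e : bool),
  [/\ fsupp eps f \subset fsupp eps f', j != i &
      forall v, eps f' v != 0 ->
        (forall l, eps f' v * P v l = (l == i)%:R) \/
        eps f' v * P v i = 1 /\ eps f' v * P v j = (-1) ^+ e].
Hypothesis all_vertices : forall v, exists f, eps f v != 0.
Hypothesis P_vertex : forall v, (forall l, `|P v l| = 1) \/
  exists i, forall l, P v l = (l == i)%:R.
Hypothesis cube_vertex : forall x : 'rV[R]_k.+1, (forall l, `|x 0 l| = 1) ->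
  exists v, exists2 a : R, a != 0 & x = a *: row v P.
Hypothesis centre_vertex : forall i, exists v, forall l, P v l = (l == i)%:R.

Variable h : 'rV[R]_N -> RP R k.
Hypothesis hL : lifts_to eps P h.

Let q_le1 f v l : `|eps f v * P v l| <= 1.
Proof.
rewrite normrM; case: (sign_cases SF f v) => ->.
- by rewrite normr0 mul0r ler01.
- by rewrite normr1 mul1r.
- by rewrite normrN1 mul1r.
Qed.

Let lift_le1 f x l : nneg x -> \sum_v x 0 v = 1 -> `|(x *m lift_mx eps P f) 0 l| <= 1.
Proof.
move=> x0 x1; rewrite lift_mxE; apply: le_trans (ler_norm_sum _ _ _) _.
rewrite -x1; apply: ler_sum => v _; rewrite normrM (ger0_norm (x0 v)).
by rewrite ler_piMr.
Qed.

(** Every vertex has coordinate 1 at i. The apex contributes 0 to all other coordinates; a base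
    vertex contributes 1 to the signed coordinate j and at most 1 in absolute value elsewhere. *)
Let lift_cases f i j (e : bool) x : j != i ->
  (forall v, eps f v != 0 -> (forall l, eps f v * P v l = (l == i)%:R) \/
        eps f v * P v i = 1 /\ eps f v * P v j = (-1) ^+ e) ->
  nneg x -> \sum_v x 0 v = 1 -> supp x \subset fsupp eps f ->
  (x *m lift_mx eps P f) 0 i = 1 /\ pyramid i j e (x *m lift_mx eps P f).
Proof.
move=> ji pf x0 x1 xf.
have nz v : x 0 v != 0 -> eps f v != 0.
  by move=> xv; have := fintype.subsetP xf v; rewrite !inE; apply.
have yi : (x *m lift_mx eps P f) 0 i = 1.
  rewrite lift_mxE -x1; apply: eq_bigr => v _.
  have [->|/nz/pf] := eqVneq (x 0 v) 0; first by rewrite mul0r.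
  by case=> [->|[-> _]]; rewrite ?eqxx mulr1.
split=> //; apply: pyramid_ineq => //.
  apply: le_trans (ler_norm _) _; rewrite normrM normrX normrN1 expr1n mul1r.
  exact: lift_le1.
move=> l li; rewrite !lift_mxE mulr_sumr; apply: le_trans (ler_norm_sum _ _ _) _.
apply: ler_sum => v _; have [->|/nz/pf pv] := eqVneq (x 0 v) 0.
  by rewrite !mul0r normr0 mulr0.
rewrite normrM (ger0_norm (x0 v)) mulrCA ler_wpM2l//.
case: pv => [H|[_ ->]]; first by rewrite !H (negPf li) (negPf ji) normr0 mulr0.
by rewrite -expr2 sqrr_sign.
Qed.

Let nice_pl : pl_map_RP (realization R K) h.
Proof.
apply: (@finitely_piecewise_fin _ _ _ _ F (fun f =>
  (* On the realization coordinates are nonnegative, so these inequalities say that x is supported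
     in f. *)
  [set x : 'rV[R]_N | forall v : {v | v \notin fsupp eps f},
     (x *m delta_mx (val v) 0) 0 0 <= 0])).
- by move=> f; exact: convex_polyhedron_fin.
- move=> x /realization_face[f /suppP xf]; exists f => -[v vf] /=.
  by rewrite -colE mxE xf// lexx.
- move=> f; exists (lift_mx eps P f), 0 => x [Kx xf]; rewrite addr0.
  have /(realizationE _ Kc)[[x0 _] x1] := Kx.
  have {}xf : supp x \subset fsupp eps f.
    apply/suppP => v vf; apply/le_anti; rewrite x0 andbT.
    by have := xf (exist _ v vf); rewrite /= -colE mxE.
  split; last exact: hL.
  split; first by move=> l; exact: lift_le1.
  have [f' [i [j [e [ff' ji pf]]]]] := in_pyramid f; exists i.
  have xf' := fintype.subset_trans xf ff'.
  have [a a1 E] := lift_mx_indep SF (realization_neq0 Kx) xf' xf.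
  have [yi _] := lift_cases ji pf x0 x1 xf'.
  by rewrite E mxE yi mulr1.
Qed.

Let nice_combinatorial : combinatorial_triangulation K h.
Proof.
split=> //.
- exact: (lifts_to_homeomorphism SF hL).
- move=> m s sK sm; split.
    have /signed_complexP[f sf] := sK.
    by have := subset_leq_card sf; rewrite card_fsupp sm ltnS.
  have [w ws] : exists w, w \in s by apply/card_gt0P; rewrite sm.
  by have := link_pl_sphere SF sK ws; rewrite sm subSS.
Qed.

(** A point of the cube boundary lies over [B i] exactly when its coordinate i is 1 or -1, and by
    convexity all vertices of its carrier then share that coordinate. This dictates the choice of
    L. *)
Let nice_equilibrium (I : {set 'I_k.+1}) : exists L : {set {set 'I_N}},
  [/\ simplicial_complex L, L \subset K & h @` realization R L = BI I].
Proof.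
pose good (s : {set 'I_N}) := `[< exists2 f, s \subset fsupp eps f &
  forall i, i \in I -> exists d : bool, forall v, v \in s ->
    eps f v * P v i = (-1) ^+ d >].
pose L := [set s in K | good s]%SET.
have inL s : (s \in L) = (s \in K) && good s by rewrite finset.in_set.
have LK : L \subset K by apply/fintype.subsetP => s; rewrite inL => /andP[].
have Lc : simplicial_complex L.
  move=> s t; rewrite !inL => /andP[sK /asboolP[f sf H]] ts.
  apply/andP; split; first exact: Kc sK ts.
  apply/asboolP; exists f; first exact: fintype.subset_trans ts sf.
  move=> i /H[d dP]; exists d => v vt; apply: dP; exact: (fintype.subsetP ts).
exists L; split=> //; apply/seteqP; split=> [p [x Lx <-]|p pI].
- have /(realizationE _ Lc)[[x0 xL] x1] := Lx.
  have Kx : realization R K x.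
    by apply/(realizationE _ Kc); split=> //; split=> //; exact: (fintype.subsetP LK).
  move: xL; rewrite inL => /andP[_ /asboolP[f xf H]] i /H[d dP].
  exists (x *m lift_mx eps P f); first exact: hL.
  move=> l; have -> : `|(x *m lift_mx eps P f) 0 i| = 1; last exact: lift_le1.
  have -> : (x *m lift_mx eps P f) 0 i = (-1) ^+ d.
    transitivity (\sum_v x 0 v * (-1) ^+ d); last by rewrite -mulr_suml x1 mul1r.
    rewrite lift_mxE; apply: eq_bigr => v _.
    have [->|xv] := eqVneq (x 0 v) 0; first by rewrite !mul0r.
    by rewrite dP ?inE.
  by rewrite normrX normrN1 expr1n.
- have [x Kx hx] := lifts_to_surj SF hL p; exists x => //.
  have /(realizationE _ Kc)[[x0 xK] x1] := Kx.
  apply/(realizationE _ Lc); split=> //; split=> //.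
  rewrite inL xK; apply/asboolP.
  have [f0 xf0] := realization_face Kx.
  have [f [i0 [j [e [ff' ji pf]]]]] := in_pyramid f0.
  have xf := fintype.subset_trans xf0 ff'; exists f => // i /pI[y py yi].
  have [yi0 _] := lift_cases ji pf x0 x1 xf.
  have := hL Kx xf; rewrite hx => px; have [a a0 E] := hcoords_prop py px.
  have : 1 <= `|(x *m lift_mx eps P f) 0 i|.
    have sc l : y 0 l = a * (x *m lift_mx eps P f) 0 l by rewrite E mxE.
    have := yi i0; rewrite !sc yi0 !normrM normr1 mulr1 => H.
    by rewrite -(ler_pM2l (_ : 0 < `|a|)) ?normr_gt0// mulr1.
  have [d dE] : exists d : bool, `|(x *m lift_mx eps P f) 0 i| =
      (-1) ^+ d * (x *m lift_mx eps P f) 0 i.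
    exists ((x *m lift_mx eps P f) 0 i < 0); case: ltP => s.
      by rewrite ltr0_norm// expr1 mulN1r.
    by rewrite ger0_norm// expr0 mul1r.
  rewrite dE => ge1; exists d => v xv; rewrite inE in xv.
  have : (-1) ^+ d * (eps f v * P v i) = 1.
    apply: (@convex_extreme R N (fun v => x 0 v)
      (fun v => (-1) ^+ d * (eps f v * P v i)) 1) xv => //.
      move=> u _; apply: le_trans (ler_norm _) _.
      by rewrite normrM normrX normrN1 expr1n mul1r.
    apply/le_anti/andP; split.
      apply: (@le_trans _ _ (\sum_u x 0 u)); last by rewrite x1.
      apply: ler_sum => u _; rewrite ler_piMr//; apply: le_trans (ler_norm _) _.
      by rewrite normrM normrX normrN1 expr1n mul1r.
    apply: le_trans ge1 _; rewrite lift_mxE mulr_sumr.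
    by apply: ler_sum => u _; rewrite mulrCA.
  move=> /(congr1 (fun t => (-1) ^+ d * t)).
  by rewrite mulr1 mulrA -expr2 sqrr_sign mul1r.
Qed.

Let nice_subdivides : subdivides_C K h.
Proof.
move=> s /signed_complexP[f0 sf0]; have [f [i [j [e [ff' ji pf]]]]] := in_pyramid f0.
have sf := fintype.subset_trans sf0 ff'.
exists i, j, e, (lift_mx eps P f); split=> // x [x0 x1 xs].
have xf : supp x \subset fsupp eps f.
  by apply: fintype.subset_trans sf; apply/suppP.
split; first by have [] := lift_cases ji pf x0 x1 xf.
apply: hL => //; apply/(realizationE _ Kc); split=> //; split=> //.
by apply/signed_complexP; exists f.
Qed.

Lemma vertices_signed_complex : vertices K = [set: 'I_N]%SET.
Proof.
apply/setP => v; rewrite finset.in_setT.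
have -> : (v \in vertices K) = ([set v]%SET \in K) by rewrite finset.in_set.
apply/signed_complexP.
by have [f fv] := all_vertices v; exists f; rewrite finset.sub1set inE.
Qed.

Let vertex_coords v : exists2 a : R, a != 0 & hcoords (h (delta_mx 0 v)) (a *: row v P).
Proof.
have [f fv] := all_vertices v; exists (eps f v) => //.
have sv : supp (delta_mx 0 v : 'rV[R]_N) \subset fsupp eps f.
  apply/suppP => u; rewrite inE negbK mxE eqxx /= => /eqP fu.
  by case: eqVneq => // uv; rewrite -uv fu eqxx in fv.
have Kv : realization R K (delta_mx 0 v).
  apply/(realizationE _ Kc); split; first split.
  - by move=> u; rewrite mxE ler0n.
  - by apply/signed_complexP; exists f.
  - rewrite (bigD1 v)//= mxE !eqxx big1 ?addr0// => u /negPf uv.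
    by rewrite mxE uv andbF.
have := hL Kv sv; rewrite (_ : delta_mx 0 v *m lift_mx eps P f = eps f v *: row v P)//.
by apply/rowP => l; rewrite -rowE mxE /lift_mx /signed_mx mul_diag_mx !mxE.
Qed.

Let nice_vertices :
  [set h (delta_mx 0 v) | v in [set` vertices K]] = @C_vertices R k.
Proof.
rewrite vertices_signed_complex; apply/seteqP; split=> p.
- case=> v _ <-; have [a a0 hv] := vertex_coords v.
  have hv1 : hcoords (h (delta_mx 0 v)) (row v P).
    have -> : row v P = a^-1 *: (a *: row v P) by rewrite scalerA mulVf// scale1r.
    by apply: hcoords_scale => //; rewrite invr_eq0.
  have [Pv|[i Pi]] := P_vertex v.
  + by left; exists (row v P) => // l; rewrite mxE.
  + right; exists i; rewrite (_ : delta_mx 0 i = row v P)//.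
    by apply/rowP => l; rewrite !mxE Pi eqxx eq_sym.
- have eq_at v (b : R) x : hcoords p x -> b != 0 -> x = b *: row v P ->
      exists2 w, [set` [set: 'I_N]%SET] w & h (delta_mx 0 w) = p.
    move=> px b0 xE; exists v; first by rewrite /= finset.inE.
    have [a a0 hv] := vertex_coords v.
    apply: (hcoords_inj hv); have -> : a *: row v P = (a / b) *: x.
      by rewrite xE scalerA divfK.
    by apply: hcoords_scale => //; rewrite mulf_neq0// invr_eq0.
  case=> [[x px x1]|[i pi]].
  + by have [v [b b0 xE]] := cube_vertex x1; exact: (eq_at v b x).
  + have [v Pv] := centre_vertex i; apply: (eq_at v 1 _ pi); first exact: oner_neq0.
    by apply/rowP => l; rewrite !mxE mul1r Pv eqxx.
Qed.

Theorem nice_signed_complex : nice_equilibrium_triangulation K h.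
Proof. by split=> //; split=> // I _; exact: nice_equilibrium. Qed.

End NiceTriangulation.

(** * The triangulation data and the finite checks *)

(* The 16 antipodal pairs of vertices of the 5-cube are numbered 0, ..., 15: v stands
   for the vertex with x_0 = 1 whose coordinate x_(l+1) is -1 exactly when bit l of v
   is 1. The centre e_i has number 16 + i. *)
Definition coordz (v l : nat) : int :=
  if (v < 16)%N then
    if l is l'.+1 then (if odd (iter l' half v) then -1 else 1) else 1
  else (v == 16 + l)%N%:Z.

Definition dotz (v : nat) (lam : seq int) : int :=
  coordz v 0 * lam`_0 + (coordz v 1 * lam`_1 + (coordz v 2 * lam`_2 +
    (coordz v 3 * lam`_3 + coordz v 4 * lam`_4))).

(* An entry (i, j, e, heights, tets) triangulates the 3-cube x_i = 1, x_j = (-1)^e;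
   vertices outside it have height 0. A tetrahedron comes with the linear form,
   free of x_i, that agrees with the heights on it and is smaller at the other
   vertices of the 3-cube. *)
Definition cube_data : seq (nat * nat * bool * seq int * seq (seq nat * seq int)) := [::
  (0%N, 1%N, false, [:: 0; 0; 2; 0; 0; 0; 0; 0; 0; 0; 6; 0; 6; 0; 2; 0],
    [:: ([:: 0; 4; 6; 8]%N, [:: 0; 0; 0; 0; 0]);
        ([:: 4; 8; 12; 14]%N, [:: 0; -2; 2; -3; -3]);
        ([:: 4; 6; 8; 14]%N, [:: 0; 0; 0; -1; -1]);
        ([:: 2; 6; 8; 14]%N, [:: 0; 0; -2; 1; -1]);
        ([:: 2; 8; 10; 14]%N, [:: 0; -1; -3; 2; -2]);
        ([:: 0; 2; 6; 8]%N, [:: 0; 0; -1; 1; 0])]);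
  (0%N, 1%N, true, [:: 0; 0; 0; 4; 0; 4; 0; 0; 0; 2; 0; 2; 0; 2; 0; 0],
    [:: ([:: 1; 3; 7; 11]%N, [:: 0; 1; -2; 2; 1]);
        ([:: 1; 7; 13; 15]%N, [:: 0; 0; 1; -1; 0]);
        ([:: 1; 5; 7; 13]%N, [:: 0; 1; 2; -2; 1]);
        ([:: 1; 9; 11; 15]%N, [:: 0; 0; 0; 1; -1]);
        ([:: 1; 9; 13; 15]%N, [:: 0; 0; 1; 0; -1]);
        ([:: 1; 7; 11; 15]%N, [:: 0; 0; -1; 1; 0])]);
  (0%N, 2%N, false, [:: 0; 4; 0; 0; 0; 2; 0; 0; 4; 4; 0; 0; 6; 0; 0; 0],
    [:: ([:: 0; 8; 9; 13]%N, [:: 0; 0; 0; 2; -2]);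
        ([:: 0; 1; 9; 13]%N, [:: 0; -2; 0; 2; 0]);
        ([:: 4; 8; 12; 13]%N, [:: 0; 3; -1; -1; -3]);
        ([:: 0; 4; 5; 13]%N, [:: 0; -1; 0; 0; 1]);
        ([:: 0; 4; 8; 13]%N, [:: 0; 2; 0; 0; -2]);
        ([:: 0; 1; 5; 13]%N, [:: 0; -2; 0; 1; 1])]);
  (0%N, 2%N, true, [:: 0; 0; 2; 0; 0; 0; 0; 0; 0; 0; 6; 0; 0; 0; 2; 4],
    [:: ([:: 2; 3; 6; 11]%N, [:: 0; 1; 0; 1; 0]);
        ([:: 2; 6; 11; 14]%N, [:: 0; 2; 0; 1; -1]);
        ([:: 2; 10; 11; 14]%N, [:: 0; 3; 1; 2; -2]);
        ([:: 6; 7; 11; 14]%N, [:: 0; 0; 0; -1; -1]);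
        ([:: 7; 11; 14; 15]%N, [:: 0; -1; 1; -2; -2]);
        ([:: 3; 6; 7; 11]%N, [:: 0; 0; 0; 0; 0])]);
  (0%N, 3%N, false, [:: 0; 4; 0; 2; 0; 0; 0; 0; 4; 4; 6; 0; 0; 0; 0; 0],
    [:: ([:: 2; 8; 10; 11]%N, [:: 0; 3; -1; -1; -3]);
        ([:: 0; 8; 9; 11]%N, [:: 0; 0; 2; 0; -2]);
        ([:: 0; 2; 8; 11]%N, [:: 0; 2; 0; 0; -2]);
        ([:: 0; 1; 9; 11]%N, [:: 0; -2; 2; 0; 0]);
        ([:: 0; 2; 3; 11]%N, [:: 0; -1; 0; 0; 1]);
        ([:: 0; 1; 3; 11]%N, [:: 0; -2; 1; 0; 1])]);
  (0%N, 3%N, true, [:: 0; 0; 0; 0; 2; 0; 0; 0; 0; 0; 0; 0; 6; 0; 2; 4],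
    [:: ([:: 4; 5; 6; 13]%N, [:: 0; 1; 1; 0; 0]);
        ([:: 5; 6; 7; 13]%N, [:: 0; 0; 0; 0; 0]);
        ([:: 7; 13; 14; 15]%N, [:: 0; -1; -2; 1; -2]);
        ([:: 6; 7; 13; 14]%N, [:: 0; 0; -1; 0; -1]);
        ([:: 4; 12; 13; 14]%N, [:: 0; 3; 2; 1; -2]);
        ([:: 4; 6; 13; 14]%N, [:: 0; 2; 1; 0; -1])]);
  (0%N, 4%N, false, [:: 2; 0; 6; 2; 4; 0; 0; 0; 0; 0; 0; 0; 0; 0; 0; 0],
    [:: ([:: 0; 4; 5; 6]%N, [:: 0; 2; 2; -1; -1]);
        ([:: 0; 2; 3; 6]%N, [:: 0; 2; -2; 3; -1]);
        ([:: 0; 1; 5; 6]%N, [:: 0; 1; 1; 0; 0]);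
        ([:: 1; 3; 6; 7]%N, [:: 0; 0; -1; 1; 0]);
        ([:: 1; 5; 6; 7]%N, [:: 0; 0; 0; 0; 0]);
        ([:: 0; 1; 3; 6]%N, [:: 0; 1; -1; 2; 0])]);
  (0%N, 4%N, true, [:: 0; 0; 0; 0; 0; 0; 0; 0; 0; 2; 6; 4; 2; 0; 0; 0],
    [:: ([:: 8; 9; 11; 15]%N, [:: 0; -1; -1; 2; 0]);
        ([:: 8; 9; 13; 15]%N, [:: 0; -1; 0; 1; 0]);
        ([:: 8; 12; 13; 14]%N, [:: 0; 1; 1; -1; 1]);
        ([:: 8; 11; 14; 15]%N, [:: 0; 0; -2; 2; 0]);
        ([:: 8; 13; 14; 15]%N, [:: 0; 0; 0; 0; 0]);
        ([:: 8; 10; 11; 14]%N, [:: 0; 1; -3; 3; 1])]);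
  (1%N, 2%N, false, [:: 2; 0; 0; 2; 0; 0; 0; 0; 2; 0; 0; 2; 6; 0; 0; 2],
    [:: ([:: 3; 4; 7; 11]%N, [:: -1; 0; 0; -1; 0]);
        ([:: 0; 4; 7; 8]%N, [:: 1; 0; 0; 1; 0]);
        ([:: 4; 7; 11; 15]%N, [:: -1; 0; 0; 0; 1]);
        ([:: 3; 4; 7; 8]%N, [:: 1; 0; 0; -1; -2]);
        ([:: 3; 4; 8; 12]%N, [:: 2; 0; -1; -2; -3]);
        ([:: 0; 4; 7; 15]%N, [:: 0; 0; 0; 1; 1])]);
  (1%N, 2%N, true, [:: 0; 0; 0; 0; 0; 0; 6; 0; 0; 4; 2; 0; 0; 2; 0; 0],
    [:: ([:: 1; 2; 9; 13]%N, [:: -1; 0; 0; -1; 2]);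
        ([:: 1; 2; 9; 14]%N, [:: 0; 0; 0; -2; 2]);
        ([:: 2; 5; 10; 14]%N, [:: 1; 0; 1; 1; -1]);
        ([:: 1; 2; 5; 13]%N, [:: -1; 0; 0; 0; 1]);
        ([:: 2; 6; 9; 14]%N, [:: 1; 0; 1; -3; 3]);
        ([:: 1; 2; 5; 14]%N, [:: 0; 0; 0; 0; 0])]);
  (1%N, 3%N, false, [:: 2; 0; 0; 0; 0; 2; 0; 0; 2; 0; 6; 0; 0; 2; 0; 2],
    [:: ([:: 0; 2; 7; 8]%N, [:: 1; 0; 1; 0; 0]);
        ([:: 2; 5; 7; 13]%N, [:: -1; 0; -1; 0; 0]);
        ([:: 2; 5; 8; 10]%N, [:: 2; 0; -2; -1; -3]);
        ([:: 2; 7; 13; 15]%N, [:: -1; 0; 0; 0; 1]);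
        ([:: 0; 2; 7; 15]%N, [:: 0; 0; 1; 0; 1]);
        ([:: 2; 5; 7; 8]%N, [:: 1; 0; -1; 0; -2])]);
  (1%N, 3%N, true, [:: 0; 0; 0; 0; 0; 0; 6; 0; 0; 4; 0; 2; 2; 0; 0; 0],
    [:: ([:: 3; 4; 12; 14]%N, [:: 1; 0; 1; 1; -1]);
        ([:: 1; 3; 4; 14]%N, [:: 0; 0; 0; 0; 0]);
        ([:: 1; 3; 4; 11]%N, [:: -1; 0; 0; 0; 1]);
        ([:: 1; 4; 9; 11]%N, [:: -1; 0; -1; 0; 2]);
        ([:: 1; 4; 9; 14]%N, [:: 0; 0; -2; 0; 2]);
        ([:: 4; 6; 9; 14]%N, [:: 1; 0; -3; 1; 3])]);
  (1%N, 4%N, false, [:: 2; 0; 2; 0; 2; 0; 0; 0; 0; 0; 0; 6; 0; 4; 0; 0],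
    [:: ([:: 2; 6; 9; 15]%N, [:: 0; 0; -1; 1; 0]);
        ([:: 0; 4; 6; 15]%N, [:: 1; 0; 1; 0; 0]);
        ([:: 2; 9; 13; 15]%N, [:: -1; 0; -2; 2; -1]);
        ([:: 4; 6; 9; 15]%N, [:: 0; 0; 1; -1; 0]);
        ([:: 4; 9; 11; 15]%N, [:: -2; 0; 3; -3; -2]);
        ([:: 0; 2; 6; 15]%N, [:: 1; 0; 0; 1; 0])]);
  (1%N, 4%N, true, [:: 0; 0; 0; 0; 0; 4; 0; 2; 0; 0; 6; 0; 2; 0; 0; 0],
    [:: ([:: 1; 3; 7; 8]%N, [:: -1; 0; 0; 1; 0]);
        ([:: 1; 5; 7; 8]%N, [:: -1; 0; -1; 2; 0]);
        ([:: 1; 5; 8; 14]%N, [:: 0; 0; -2; 2; 0]);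
        ([:: 1; 3; 8; 14]%N, [:: 0; 0; 0; 0; 0]);
        ([:: 5; 8; 10; 14]%N, [:: 1; 0; -3; 3; 1]);
        ([:: 3; 8; 12; 14]%N, [:: 1; 0; 1; -1; 1])]);
  (2%N, 3%N, false, [:: 0; 2; 0; 0; 0; 0; 4; 0; 2; 0; 0; 0; 0; 0; 0; 2],
    [:: ([:: 0; 1; 9; 14]%N, [:: 1; -1; 0; -1; 1]);
        ([:: 0; 7; 14; 15]%N, [:: -1; 1; 0; -1; 1]);
        ([:: 6; 7; 9; 14]%N, [:: -2; -2; 0; -2; -2]);
        ([:: 0; 7; 8; 9]%N, [:: 1; 1; 0; -1; -1]);
        ([:: 0; 7; 9; 14]%N, [:: 0; 0; 0; 0; 0])]);
  (2%N, 3%N, true, [:: 0; 0; 0; 0; 2; 0; 0; 0; 0; 0; 4; 2; 6; 2; 0; 0],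
    [:: ([:: 2; 3; 5; 11]%N, [:: -1; 0; 0; 0; 1]);
        ([:: 3; 4; 5; 13]%N, [:: 2; 1; 0; 0; -1]);
        ([:: 2; 5; 10; 11]%N, [:: -2; -1; 0; 1; 2]);
        ([:: 3; 4; 12; 13]%N, [:: 3; 2; 0; 1; -2]);
        ([:: 3; 4; 5; 11]%N, [:: 0; 1; 0; 0; 1]);
        ([:: 2; 3; 5; 13]%N, [:: 1; 0; 0; 0; -1])]);
  (2%N, 4%N, false, [:: 0; 2; 0; 0; 2; 0; 0; 0; 0; 0; 6; 4; 0; 0; 0; 0],
    [:: ([:: 0; 5; 14; 15]%N, [:: 0; 0; 0; 0; 0]);
        ([:: 4; 5; 11; 15]%N, [:: -1; 1; 0; -2; 0]);
        ([:: 5; 11; 14; 15]%N, [:: -2; 0; 0; -2; 0]);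
        ([:: 5; 10; 11; 14]%N, [:: -3; -1; 0; -3; -1]);
        ([:: 0; 1; 5; 14]%N, [:: 1; -1; 0; 1; -1]);
        ([:: 0; 4; 5; 15]%N, [:: 0; 1; 0; -1; 0])]);
  (2%N, 4%N, true, [:: 0; 0; 2; 0; 0; 0; 4; 4; 2; 0; 0; 0; 4; 0; 0; 0],
    [:: ([:: 2; 3; 9; 13]%N, [:: -1; -1; 0; 0; 0]);
        ([:: 3; 7; 8; 9]%N, [:: -1; 1; 0; 2; 0]);
        ([:: 3; 8; 9; 13]%N, [:: 1; 1; 0; 0; 0]);
        ([:: 2; 3; 6; 9]%N, [:: -2; -1; 0; 1; 0]);
        ([:: 3; 6; 7; 9]%N, [:: -2; 0; 0; 2; 0]);
        ([:: 3; 8; 12; 13]%N, [:: 2; 2; 0; -1; 1])]);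
  (3%N, 4%N, false, [:: 0; 2; 2; 0; 0; 0; 0; 0; 0; 0; 0; 0; 6; 4; 0; 0],
    [:: ([:: 0; 2; 3; 15]%N, [:: 0; 1; -1; 0; 0]);
        ([:: 3; 12; 13; 14]%N, [:: -3; -1; -3; 0; -1]);
        ([:: 0; 3; 14; 15]%N, [:: 0; 0; 0; 0; 0]);
        ([:: 0; 1; 3; 14]%N, [:: 1; -1; 1; 0; -1]);
        ([:: 3; 13; 14; 15]%N, [:: -2; 0; -2; 0; 0]);
        ([:: 2; 3; 13; 15]%N, [:: -1; 1; -2; 0; 0])]);
  (3%N, 4%N, true, [:: 0; 0; 0; 0; 2; 0; 4; 4; 2; 0; 4; 0; 0; 0; 0; 0],
    [:: ([:: 5; 8; 9; 11]%N, [:: 1; 1; 0; 0; 0]);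
        ([:: 5; 6; 7; 9]%N, [:: -2; 0; 2; 0; 0]);
        ([:: 4; 5; 6; 9]%N, [:: -2; -1; 1; 0; 0]);
        ([:: 5; 8; 10; 11]%N, [:: 2; 2; -1; 0; 1]);
        ([:: 4; 5; 9; 11]%N, [:: -1; -1; 0; 0; 0]);
        ([:: 5; 7; 8; 9]%N, [:: -1; 1; 2; 0; 0])])]%Z.

(** A sign vector as two bit sets: the vertices with sign 1 and those with sign -1. *)
Definition signed_mask := (N * N)%type.

Definition mask_bit (m : N) (v : nat) : bool := N.testbit m (N.of_nat v).

Definition mask_sign (m : signed_mask) (v : nat) : int :=
  (mask_bit m.1 v)%:Z - (mask_bit m.2 v)%:Z.

Definition mask_flip (b : bool) (m : signed_mask) : signed_mask :=
  if b then (m.2, m.1) else m.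

Definition mask_of (p : pred nat) : N :=
  foldr (fun v m => if p v then N.setbit m (N.of_nat v) else m) 0%num (iota 0 21).

Definition mask_and (m m' : signed_mask) : signed_mask :=
  (N.land m.1 m'.1, N.land m.2 m'.2).

Definition mask_sub (m m' : signed_mask) : bool :=
  N.eqb (N.land m.1 m'.1) m.1 && N.eqb (N.land m.2 m'.2) m.2.

Definition mask_meet (m m' : signed_mask) : bool :=
  ~~ (N.eqb (N.land m.1 m'.1) 0 && N.eqb (N.land m.2 m'.2) 0).

Definition mask_clear (m : signed_mask) (v : nat) : signed_mask :=
  (N.clearbit m.1 (N.of_nat v), N.clearbit m.2 (N.of_nat v)).

(** A bit present in both sets would give [mask_sign] the value 0 and hide the vertex. *)
Definition mask_disjoint (m : signed_mask) : bool := N.eqb (N.land m.1 m.2) 0.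

(* A cell is the pyramid with apex e_i over the facet x_j = (-1)^e of the cube
   x_i = 1. *)
Definition cell := (nat * nat * bool * signed_mask * seq int)%type.

(** A cube vertex v gets the sign a for which a v lies in the base of the pyramid; the apex is taken
    as e_i itself. *)
Definition cell_mask (i j : nat) (e : bool) : signed_mask :=
  let inQ a v := if (v < 16)%N then (coordz v i == a) && (coordz v j == (if e then - a else a))
                 else (a == 1) && (v == 16 + i)%N in
  (mask_of (inQ 1), mask_of (inQ (-1))).

Definition mk_cell (i j : nat) (e : bool) (ht : seq int) : cell :=
  (i, j, e, cell_mask i j e, ht).

Definition simplex_mask (i j : nat) (e : bool) (tet : seq nat) : signed_mask :=
  let m := mask_of (fun v => v \in (16 + i)%N :: tet) in
  mask_and (m, m) (cell_mask i j e).

(* Each 3-cube is the base of two cells, with apex e_i and, after multiplication by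
   (-1)^e, with apex e_j. *)
Definition swap_form (i j : nat) (e : bool) (lam : seq int) : seq int :=
  [seq if l == i then lam`_j else if l == j then 0 else
       (if e then - lam`_l else lam`_l) | l <- iota 0 5].

Definition rp4_cells : seq cell := Eval vm_compute in
  flatten [seq let: (i, j, e, ht, tets) := d in
               [:: mk_cell i j e ht; mk_cell j i e ht] | d <- cube_data].

(* A facet is the number of its cell, its signed vertices and its linear form. *)
Definition facet := (nat * signed_mask * seq int)%type.

(** The numbers 2d and 2d + 1 are the positions in [rp4_cells] of the two cells made from entry
    d. *)
Definition rp4_facets : seq facet := Eval vm_compute in
  flatten [seq let: (d, (i, j, e, ht, tets)) := nd in
     [seq (d.*2, simplex_mask i j e t.1, t.2) | t : seq nat * seq int <- tets] ++
     [seq (d.*2.+1, simplex_mask j i e t.1, swap_form i j e t.2)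
        | t : seq nat * seq int <- tets]
   | nd <- zip (iota 0 20) cube_data].

Definition cell0 : cell := (0%N, 0%N, false, (0%num, 0%num), [::]).
Definition facet0 : facet := (0%N, (0%num, 0%num), [::]).

Definition fcell (f : facet) : nat := f.1.1.
Definition fmask (f : facet) : signed_mask := f.1.2.
Definition fform (f : facet) : seq int := f.2.
Definition cmask (c : cell) : signed_mask := c.1.2.
Definition cheight (c : cell) : seq int := c.2.
Definition cindex (c : cell) : nat * nat * bool := c.1.1.

(** The linear piece, on the cone over this pyramid, of twice the largest plus the second largest
    absolute coordinate. That function is 3 at cube vertices and 2 at centres, the values of
    [height1]. *)
Definition cform (c : cell) : seq int :=
  let: (i, j, e) := cindex c in
  [seq if l == i then 2%Z else if l == j then (if e then -1 else 1)%Z else 0%Z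
    | l <- iota 0 5].

Definition height1 (v : nat) : int := if (v < 16)%N then 3%Z else 2%Z.

Section Checks.
Variables (cells : seq cell) (facets : seq facet).

Definition cell_facets (c : nat) : seq facet := [seq f <- facets | fcell f == c].

Definition check_facet (f : facet) : bool :=
  let c := nth cell0 cells (fcell f) in
  [&& mask_disjoint (fmask f), (fcell f < size cells)%N, mask_sub (fmask f) (cmask c),
      count (fun v => mask_sign (fmask f) v != 0) (iota 0 21) == 5%N &
      all (fun v => let s := mask_sign (cmask c) v in
         (s != 0) ==>
         (* Heights are listed for the 16 cube vertices only. The apex gets the default 0, which is
            also the value there of a form free of the apex coordinate. *)
         ((s * dotz v (fform f) <= (cheight c)`_v) &&
          ((s * dotz v (fform f) == (cheight c)`_v) == (mask_sign (fmask f) v != 0))))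
        (iota 0 21)].

Definition check_cell (c : cell) : bool :=
  mask_disjoint (cmask c) &&
  all (fun v => all (fun e : int =>
      (e * dotz v (cform c) <= height1 v) &&
      ((e * dotz v (cform c) == height1 v) == (mask_sign (cmask c) v == e)))
    [:: 1; -1]) (iota 0 21).

(** By symmetry one lift of each facet is enough. A neighbour inside the same cell must be the
    listed lift, hence [~~ b]; otherwise it suffices that the cell of the neighbour lacks the signed
    vertex v. *)
Definition check_wall (f : facet) : bool :=
  all (fun v => let s := mask_sign (fmask f) v in
    (s != 0) ==>
    let m := mask_clear (fmask f) v in
    has (fun f' => has (fun b =>
       if mask_sub m (mask_flip b (fmask f')) then
         [&& ~~ b, fcell f' == fcell f & mask_sign (fmask f') v == 0] ||
         (mask_sign (mask_flip b (cmask (nth cell0 cells (fcell f')))) v != s)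
       else false) [:: false; true]) facets) (iota 0 21).

(** Ensures that pyramids subdivide common faces alike, although their second heights need not
    agree. *)
Definition check_cell_face (c : nat) : bool :=
  let cm := cmask (nth cell0 cells c) in
  let fs := cell_facets c in
  all (fun f => all (fun b =>
    let m := mask_and (mask_flip b (fmask f)) cm in
    has (fun f' => mask_sub m (fmask f')) fs) [:: false; true]) facets.

(** Excludes that edges vw and v(-w) both occur, so that the antipodal quotient is a simplicial
    complex. *)
Definition check_consistent (f : facet) : bool :=
  all (fun f' => ~~ (mask_meet (fmask f) (fmask f') &&
                     mask_meet (fmask f) (mask_flip true (fmask f')))) facets.

Definition facet_in_pyramid (i j : nat) (e : bool) (f : facet) : bool :=
  [&& (i < 5)%N, (j < 5)%N, j != i &
   all (fun v => let s := mask_sign (fmask f) v in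
    (s != 0) ==>
    (all (fun l => s * coordz v l == (l == i)%N%:Z) (iota 0 5) ||
     ((s * coordz v i == 1) && (s * coordz v j == (if e then -1 else 1))))) (iota 0 21)].

Definition check_pyramid (f : facet) : bool :=
  let c := cindex (nth cell0 cells (fcell f)) in facet_in_pyramid c.1.1 c.1.2 c.2 f.

Definition data_ok : Prop :=
  [/\ all check_facet facets, all check_cell cells,
      all check_wall facets & all check_cell_face (iota 0 (size cells))] /\
  [/\ all check_consistent facets, all check_pyramid facets,
      all (fun v => has (fun f => mask_sign (fmask f) v != 0) facets) (iota 0 21) &
      (0 < size facets)%N].

End Checks.

Lemma rp4_data_ok : data_ok rp4_cells rp4_facets.
Proof. by split; split; vm_compute. Qed.

(** * Arithmetic of sign masks *)

Lemma mask_bit_land m m' v : mask_bit (N.land m m') v = mask_bit m v && mask_bit m' v.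
Proof. exact: N.land_spec. Qed.

Lemma mask_sign_flip b m v : mask_sign (mask_flip b m) v = (-1) ^+ b * mask_sign m v.
Proof.
rewrite /mask_sign; case: b => /=; first by rewrite expr1 mulN1r opprB.
by rewrite expr0 mul1r.
Qed.

Lemma mask_sign_cases m v :
  [\/ mask_sign m v = 0, mask_sign m v = 1 | mask_sign m v = -1].
Proof.
rewrite /mask_sign; case: (mask_bit _ _); case: (mask_bit _ _).
- by constructor 1.
- by constructor 2.
- by constructor 3.
- by constructor 1.
Qed.

Lemma mask_disjoint_flip b m : mask_disjoint m -> mask_disjoint (mask_flip b m).
Proof. by case: b => //; rewrite /mask_disjoint /= N.land_comm. Qed.

Lemma mask_disjointP m v : mask_disjoint m -> mask_bit m.1 v && mask_bit m.2 v = false.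
Proof. by move=> /N.eqb_eq e; rewrite -mask_bit_land e /mask_bit N.bits_0. Qed.

Lemma mask_sub_sign m m' v : mask_sub m m' -> mask_disjoint m' ->
  mask_sign m v != 0 -> mask_sign m' v = mask_sign m v.
Proof.
move=> /andP[/N.eqb_eq e1 /N.eqb_eq e2] /(@mask_disjointP _ v).
have := mask_bit_land m.1 m'.1 v; have := mask_bit_land m.2 m'.2 v.
rewrite e1 e2 /mask_sign.
by case: (mask_bit m.1 v); case: (mask_bit m.2 v); case: (mask_bit m'.1 v);
  case: (mask_bit m'.2 v).
Qed.

Lemma mask_sign_and m m' v : mask_disjoint m -> mask_disjoint m' ->
  mask_sign m v != 0 -> mask_sign m' v = mask_sign m v ->
  mask_sign (mask_and m m') v != 0.
Proof.
move=> /(@mask_disjointP _ v) d /(@mask_disjointP _ v) d'; move: d d'.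
rewrite /mask_sign /= !mask_bit_land.
by case: (mask_bit m.1 v); case: (mask_bit m.2 v); case: (mask_bit m'.1 v);
  case: (mask_bit m'.2 v).
Qed.

Lemma mask_meet_sign m m' v : mask_disjoint m -> mask_disjoint m' ->
  mask_sign m v != 0 -> mask_sign m' v = mask_sign m v -> mask_meet m m'.
Proof.
move=> d d' nz e; apply/negP => /andP[/N.eqb_eq e1 /N.eqb_eq e2].
have := mask_sign_and d d' nz e; rewrite /mask_sign /mask_bit /= e1 e2.
by rewrite !N.bits_0 subrr eqxx.
Qed.

Lemma mask_sign_clear m u v : u != v -> mask_sign (mask_clear m v) u = mask_sign m u.
Proof.
move=> uv; have ne : N.of_nat v <> N.of_nat u.
  by move=> /Nnat.Nat2N.inj e; rewrite e eqxx in uv.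
by rewrite /mask_sign /mask_bit /= !N.clearbit_neq.
Qed.

Lemma intr_sign (R : realType) (b : bool) (x : int) :
  ((-1) ^+ b * x)%:~R = (-1) ^+ b * x%:~R :> R.
Proof. by rewrite rmorphM rmorphXn rmorphN1. Qed.

(** * The checked data give a symmetric fan in R^5 *)

Section FiveCube.
Variables (R : realType) (cells : seq cell) (facets : seq facet).
Hypothesis ok : data_ok cells facets.

Let facets_ok : all (check_facet cells) facets. Proof. by have [[]] := ok. Qed.
Let cells_ok : all check_cell cells. Proof. by have [[]] := ok. Qed.
Let walls_ok : all (check_wall cells facets) facets. Proof. by have [[]] := ok. Qed.
Let cell_faces_ok : all (check_cell_face cells facets) (iota 0 (size cells)).
Proof. by have [[]] := ok. Qed.
Let consistent_ok : all (check_consistent facets) facets.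
Proof. by have [_ []] := ok. Qed.
Let pyramids_ok : all (check_pyramid cells) facets. Proof. by have [_ []] := ok. Qed.
Let vertices_ok :
  all (fun v => has (fun f => mask_sign (fmask f) v != 0) facets) (iota 0 21).
Proof. by have [_ []] := ok. Qed.

(** The boolean chooses between the listed lift of a facet and its antipode. *)
Definition rp4_facet := ('I_(size facets) * bool)%type.

Definition rp4_mask (f : rp4_facet) : signed_mask :=
  mask_flip f.2 (fmask (nth facet0 facets f.1)).

Definition rp4_eps (f : rp4_facet) (v : 'I_21) : R := (mask_sign (rp4_mask f) v)%:~R.

Definition rp4_pos : 'M[R]_(21, 5) := \matrix_(v, l) (coordz v l)%:~R.

Definition rp4_cell (f : rp4_facet) : nat * bool :=
  (fcell (nth facet0 facets f.1), f.2).

Let ccell (c : nat * bool) : cell := nth cell0 cells c.1.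
Let cm c : signed_mask := mask_flip c.2 (cmask (ccell c)).
Let eta c (v : 'I_21) : R := (mask_sign (cm c) v)%:~R.
Let form (b : bool) (lam : seq int) : 'cV[R]_5 := (-1) ^+ b *: \col_l (lam`_l)%:~R.
Let lam1 (c : nat * bool) := form c.2 (cform (ccell c)).
Let lam2 (f : rp4_facet) := form f.2 (fform (nth facet0 facets f.1)).
Let mu1 (v : 'I_21) : R := (height1 v)%:~R.
Let mu2 (c : nat * bool) (v : 'I_21) : R := ((cheight (ccell c))`_v)%:~R.

Let placed_form b lam v :
  placed rp4_pos (form b lam) v = ((-1) ^+ b * dotz v lam)%:~R.
Proof.
rewrite /placed /form -scalemxAr mxE intr_sign; congr (_ * _).
rewrite mxE !big_ord_recl big_ord0 !mxE /= /dotz !rmorphD !rmorphM /= addr0.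
by [].
Qed.

Let eps_neq0 f v : (rp4_eps f v != 0) = (mask_sign (rp4_mask f) v != 0).
Proof. by rewrite /rp4_eps intr_eq0. Qed.

Let facet_at (i : 'I_(size facets)) : check_facet cells (nth facet0 facets i).
Proof. by apply: (all_nthP facet0 facets_ok). Qed.

Let fdisj f : mask_disjoint (rp4_mask f).
Proof. by apply: mask_disjoint_flip; have /and5P[] := facet_at f.1. Qed.

Let fcell_lt f : ((rp4_cell f).1 < size cells)%N.
Proof. by have /and5P[] := facet_at f.1. Qed.

Let cell_at c : (c.1 < size cells)%N -> check_cell (ccell c).
Proof. by move=> lt; apply: (all_nthP cell0 cells_ok). Qed.

Let sign_in_iota (v : 'I_21) : (v : nat) \in iota 0 21.
Proof. by rewrite mem_iota add0n ltn_ord. Qed.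

Let cdisj c : mask_disjoint (cm c).
Proof.
apply: mask_disjoint_flip.
have [lt|le] := ltnP c.1 (size cells); first by have /andP[] := cell_at lt.
by rewrite /ccell nth_default.
Qed.

Let rp4_signs f v : [\/ rp4_eps f v = 0, rp4_eps f v = 1 | rp4_eps f v = -1].
Proof.
rewrite /rp4_eps; case: (mask_sign_cases (rp4_mask f) v) => ->.
- by constructor 1.
- by constructor 2.
- by constructor 3; rewrite rmorphN1.
Qed.

Let eta_eps f v : rp4_eps f v != 0 -> eta (rp4_cell f) v = rp4_eps f v.
Proof.
rewrite eps_neq0 => nz; rewrite /eta /rp4_eps; congr _%:~R.
apply: mask_sub_sign nz => //; have /and5P[_ _ + _ _] := facet_at f.1.
rewrite /cm /rp4_mask /rp4_cell /=; case: f.2 => //= /andP[a b].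
by apply/andP.
Qed.

(** The height condition holds for listed cells; the default [cell0] violates it at the centre
    e_0. *)
Let fin_cell : Type := {c : nat * bool | (c.1 < size cells)%N}.

Lemma sign_mul_eq (b : bool) (x y : int) : ((-1) ^+ b * x == y) = (x == (-1) ^+ b * y).
Proof.
by case: b; rewrite ?expr1 ?expr0 ?mul1r// !mulN1r eqr_oppLR.
Qed.

Let lam1_leif (c : fin_cell) v (e : R) : e = 1 \/ e = -1 ->
  e * placed rp4_pos (lam1 (val c)) v <= mu1 v ?= iff (eta (val c) v == e).
Proof.
case: c => [[c b] lt] /= eE.
have [d ->] : exists d : bool, e = ((-1) ^+ d : int)%:~R.
  by case: eE => ->; [exists false|exists true; rewrite rmorphN1].
have /andP[_ /allP/(_ _ (sign_in_iota v))/= /and3P[p1 p2 _]] := cell_at lt.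
have /andP[le eq] : ((-1) ^+ d * ((-1) ^+ b * dotz v (cform (ccell (c, b)))) <= height1 v)
   && ((((-1) ^+ d * ((-1) ^+ b * dotz v (cform (ccell (c, b)))) == height1 v)) ==
      (mask_sign (cm (c, b)) v == (-1) ^+ d)).
  have key (a : bool) : ((-1) ^+ a * dotz v (cform (ccell (c, b))) <= height1 v) &&
      (((-1) ^+ a * dotz v (cform (ccell (c, b))) == height1 v) ==
       (mask_sign (cmask (ccell (c, b))) v == (-1) ^+ a)).
    by case: a; [exact: p2|exact: p1].
  rewrite /cm mask_sign_flip /= (sign_mul_eq b (mask_sign _ _)) mulrA.
  rewrite [(-1) ^+ b * _]mulrC -signr_addb.
  exact: key.
rewrite placed_form -rmorphM /= /mu1 /eta; split.
- by rewrite ler_int.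
- by rewrite !eqr_int (eqP eq).
Qed.

Let lam2_leif f v : eta (rp4_cell f) v != 0 ->
  eta (rp4_cell f) v * placed rp4_pos (lam2 f) v <= mu2 (rp4_cell f) v
    ?= iff (rp4_eps f v != 0).
Proof.
rewrite /eta intr_eq0 => nz; rewrite placed_form -rmorphM /= /mu2.
have /and5P[_ _ _ _ /allP/(_ _ (sign_in_iota v))/implyP] := facet_at f.1.
rewrite eps_neq0 /rp4_mask; move: nz; rewrite /cm !mask_sign_flip /ccell /=.
have sg : (-1) ^+ f.2 != 0 :> int by rewrite signr_eq0.
rewrite !mulf_eq0 !(negPf sg) /= => nz /(_ nz) /andP[le /eqP eq].
rewrite mulrACA -expr2 sqrr_sign mul1r; split; first by rewrite ler_int.
by rewrite eqr_int.
Qed.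

Let rp4_card f : #|fsupp rp4_eps f| = 5.
Proof.
have /and5P[_ _ _ /eqP c5 _] := facet_at f.1.
rewrite -[RHS]c5 -sum1_count.
transitivity (\sum_(0 <= v < 21 | mask_sign (fmask (nth facet0 facets f.1)) v != 0) 1)%N.
  rewrite big_mkord -sum1_card; apply: eq_bigl => v.
  by rewrite inE eps_neq0 /rp4_mask mask_sign_flip mulf_eq0 signr_eq0.
by [].
Qed.

Let cls f : fin_cell := exist _ (rp4_cell f) (fcell_lt f).

Let flip_sub b m m' : mask_sub m m' -> mask_sub (mask_flip b m) (mask_flip b m').
Proof. by case: b => //= /andP[? ?]; apply/andP. Qed.

Let flip_flip b b' m : mask_flip b (mask_flip b' m) = mask_flip (b (+) b') m.
Proof. by case: b b' m => [] [] []. Qed.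

Let flip_clear b m v : mask_flip b (mask_clear m v) = mask_clear (mask_flip b m) v.
Proof. by case: b. Qed.

Let wall f v : rp4_eps f v != 0 -> exists f',
  (forall u, u != v -> rp4_eps f u != 0 -> rp4_eps f' u = rp4_eps f u) /\
  (cls f' = cls f /\ rp4_eps f' v = 0 \/ eta (val (cls f')) v != rp4_eps f v).
Proof.
case: f => [f b]; rewrite eps_neq0 => nz.
have /allP/(_ _ (sign_in_iota v)) := all_nthP facet0 walls_ok _ (ltn_ord f).
have nz0 : mask_sign (fmask (nth facet0 facets f)) v != 0.
  by move: nz; rewrite /rp4_mask mask_sign_flip mulf_eq0 signr_eq0.
move=> /implyP/(_ nz0)/(elimT (has_nthP facet0)) [i lt] /hasP[b' _].
case: ifP => // sub P.
pose f' : rp4_facet := (Ordinal lt, b (+) b'); exists f'; split.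
- move=> u uv; rewrite eps_neq0 => fu; rewrite /rp4_eps; congr _%:~R.
  have clr : mask_sign (mask_clear (rp4_mask (f, b)) v) u = mask_sign (rp4_mask (f, b)) u.
    by apply: mask_sign_clear; apply: contra uv => /eqP e; apply/eqP/val_inj.
  rewrite -clr; apply: mask_sub_sign; rewrite ?clr//.
  by rewrite /rp4_mask /= -flip_clear -flip_flip; exact: flip_sub.
- case/orP: P => [/and3P[/negPf b'0 /eqP cf /eqP v0]|ne].
    left; split; last by rewrite /rp4_eps /rp4_mask /= mask_sign_flip v0 mulr0.
    by apply/val_inj; rewrite /= /rp4_cell /= cf b'0 addbF.
  right; rewrite /eta /rp4_eps eqr_int /cm /rp4_mask /ccell /= -flip_flip.
  rewrite !(mask_sign_flip b) sign_mul_eq mulrA -expr2 sqrr_sign mul1r.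
  exact: ne.
Qed.

Let cell_face f0 f : exists2 f', cls f' = cls f0 &
  forall v, rp4_eps f v != 0 -> eta (val (cls f0)) v = rp4_eps f v -> rp4_eps f' v != 0.
Proof.
case: f0 f => [f0 b0] [f b].
have c_in : fcell (nth facet0 facets f0) \in iota 0 (size cells).
  by rewrite mem_iota add0n; have := fcell_lt (f0, b0).
have /(all_nthP facet0)/(_ f (ltn_ord f)) := allP cell_faces_ok _ c_in.
move=> /allP/(_ (b0 (+) b)) H.
have /H : b0 (+) b \in [:: false; true] by case: (b0 (+) b).
rewrite /cell_facets => /hasP[x]; rewrite mem_filter => /andP[/eqP cx].
move=> /(nthP facet0)[i lt xE] sub; subst x.
exists (Ordinal lt, b0); first by apply/val_inj; rewrite /= /rp4_cell /= cx.
move=> v; rewrite !eps_neq0 /eta /rp4_eps => nz /eqP; rewrite eqr_int => /eqP e.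
have n1 : mask_sign (mask_and (rp4_mask (f, b)) (cm (rp4_cell (f0, b0)))) v != 0.
  by apply: mask_sign_and; rewrite ?fdisj ?cdisj.
have sub' : mask_sub (mask_and (rp4_mask (f, b)) (cm (rp4_cell (f0, b0))))
                     (rp4_mask (Ordinal lt, b0)).
  move: sub; rewrite /rp4_mask /cm /rp4_cell /ccell /=.
  move=> /(flip_sub b0); congr (mask_sub _ _).
  by case: b0 b {H n1 e nz c_in} => [] [].
by rewrite (mask_sub_sign sub' _ n1).
Qed.

Let rp4_opp f : exists f', forall v, rp4_eps f' v = - rp4_eps f v.
Proof.
exists (f.1, ~~ f.2) => v; rewrite /rp4_eps /rp4_mask !mask_sign_flip /=.
by rewrite !intr_sign signrN mulNr.
Qed.

Let rp4_consistent f f' v w : rp4_eps f v != 0 -> rp4_eps f' v = rp4_eps f v ->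
  rp4_eps f w != 0 -> rp4_eps f' w != 0 -> rp4_eps f' w = rp4_eps f w.
Proof.
rewrite !eps_neq0 /rp4_eps => fv /eqP; rewrite eqr_int => /eqP ev fw f'w.
congr _%:~R; have [//|ne] := eqVneq (mask_sign (rp4_mask f') w) (mask_sign (rp4_mask f) w).
have ew : mask_sign (mask_flip true (rp4_mask f')) w = mask_sign (rp4_mask f) w.
  move: fw f'w ne; rewrite mask_sign_flip.
  by case: (mask_sign_cases (rp4_mask f) w) => ->;
     case: (mask_sign_cases (rp4_mask f') w) => ->.
have m1 := mask_meet_sign (fdisj f) (fdisj f') fv ev.
have m2 := mask_meet_sign (fdisj f) (mask_disjoint_flip true (fdisj f')) fw ew.
have /(all_nthP facet0)/(_ f'.1 (ltn_ord _)) :=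
  all_nthP facet0 consistent_ok _ (ltn_ord f.1).
move: m1 m2; rewrite /rp4_mask flip_flip.
have meetC m m' : mask_meet (mask_flip true m) m' = mask_meet m (mask_flip true m').
  by rewrite /mask_meet /= andbC.
have ff m : mask_flip true (mask_flip true m) = m by case: m.
by case: f.2; case: f'.2; rewrite /= -/(mask_flip true _) -?/(mask_flip true _)
  ?meetC ?ff => m1 m2; rewrite ?m1 ?m2.
Qed.

Lemma rp4_signed_fan : signed_fan rp4_eps rp4_pos.
Proof.
have [_ [_ _ _ size_gt0]] := ok; pose f0 : rp4_facet := (Ordinal size_gt0, false).
exact: (@signed_fanP R 21 5 _ _ rp4_eps cls (fun c => eta (val c)) rp4_pos
  (fun c => lam1 (val c)) lam2 mu1 (fun c => mu2 (val c))
  rp4_signs eta_eps lam1_leif lam2_leif wall cell_face rp4_card rp4_opp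
  rp4_consistent f0).
Qed.

Let pos_cases (v : 'I_21) : (forall l : 'I_5, `|rp4_pos v l| = 1) \/
  exists i : 'I_5, forall l, rp4_pos v l = (l == i)%:R.
Proof.
have [lt|ge] := ltnP v 16.
  left=> l; rewrite mxE /coordz lt; case: (l : nat) => [|l']; first by rewrite normr1.
  by case: ifP => _; rewrite ?rmorphN1 ?normrN1 ?normr1.
have lt : (v - 16 < 5)%N by rewrite ltn_subLR ?(ltn_ord v).
right; exists (Ordinal lt) => l; rewrite mxE /coordz ltnNge ge /=.
rewrite -val_eqE /= -(eqn_add2l 16 l) subnKC//.
by rewrite eq_sym; case: eqP.
Qed.

Let pos_le1 v l : `|rp4_pos v l| <= 1.
Proof.
have [->|[i ->]] := pos_cases v; first exact: lexx.
by case: eqP; rewrite ?normr1 ?normr0 ?ler01.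
Qed.

Let in_pyramid f : exists f' i j (e : bool),
  [/\ fsupp rp4_eps f \subset fsupp rp4_eps f', j != i &
      forall v, rp4_eps f' v != 0 ->
        (forall l, rp4_eps f' v * rp4_pos v l = (l == i)%:R) \/
        rp4_eps f' v * rp4_pos v i = 1 /\ rp4_eps f' v * rp4_pos v j = (-1) ^+ e].
Proof.
have := all_nthP facet0 pyramids_ok _ (ltn_ord f.1); rewrite /check_pyramid.
move: (cindex _).1.1 (cindex _).1.2 (cindex _).2 => i j e /and4P[i5 j5 ji H].
exists (f.1, false), (Ordinal i5), (Ordinal j5), e; split=> //.
  apply/fintype.subsetP => v; rewrite !inE !eps_neq0 /rp4_mask !mask_sign_flip.
  by rewrite !mulf_eq0 !signr_eq0.
move=> v; rewrite eps_neq0 /rp4_eps /rp4_mask /= => nz.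
have /implyP/(_ nz)/orP[a|/andP[/eqP a /eqP b]] := allP H _ (sign_in_iota v).
  by left=> l; rewrite mxE -rmorphM /= (eqP (allP a (val l) _)) ?mem_iota ?add0n ?ltn_ord//.
right; rewrite !mxE -!rmorphM /= a b; split=> //.
by case: e {H b}; rewrite ?rmorphN1.
Qed.

Let rp4_vertices v : exists f, rp4_eps f v != 0.
Proof.
have /(elimT (has_nthP facet0)) [i lt nz] := allP vertices_ok _ (sign_in_iota v).
by exists (Ordinal lt, false); rewrite eps_neq0.
Qed.

Let cube_number (b1 b2 b3 b4 : bool) : nat := b1 + 2 * b2 + 4 * b3 + 8 * b4.

Let cube_vertex (x : 'rV[R]_5) : (forall l, `|x 0 l| = 1) ->
  exists v, exists2 a : R, a != 0 & x = a *: row v rp4_pos.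
Proof.
(* Dividing x by its coordinate 0 gives the representative with first coordinate 1; the bits record
   which coordinates differ from it in sign. *)
move=> x1; pose b l := x 0 (inord l) != x 0 0.
have lt : (cube_number (b 1) (b 2) (b 3) (b 4) < 21)%N.
  by case: (b 1); case: (b 2); case: (b 3); case: (b 4).
have xl (l : nat) : x 0 (inord l) = x 0 0 * (-1) ^+ b l.
  rewrite /b; case: eqVneq => [->|ne] /=; first by rewrite expr0 mulr1.
  have /eqP : `|x 0 (inord l)| = `|x 0 0| by rewrite !x1.
  by rewrite eqr_norm2 (negPf ne) => /eqP ->; rewrite expr1 mulrN1.
exists (Ordinal lt), (x 0 0); first by rewrite -normr_gt0 x1.
have key (b1 b2 b3 b4 : bool) (l : 'I_5) :
    coordz (cube_number b1 b2 b3 b4) l = (-1) ^+ nth false [:: false; b1; b2; b3; b4] l.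
  by case: l => [[|[|[|[|[|]]]]] ?] //; case: b1; case: b2; case: b3; case: b4.
apply/rowP => l; rewrite !mxE key rmorphXn rmorphN1 /=.
have : x 0 l = x 0 0 * (-1) ^+ b l by rewrite -xl inord_val.
have b0 : b 0%N = false.
  have i0 : inord 0 = 0 :> 'I_5 by apply/val_inj; rewrite /= inordK.
  by rewrite /b i0 eqxx.
by case: l => [[|[|[|[|[|]]]]] ?] //= ->; rewrite b0.
Qed.

Let centre_vertex (i : 'I_5) : exists v, forall l, rp4_pos v l = (l == i)%:R.
Proof.
have lt : (16 + i < 21)%N by rewrite -[21%N]/(16 + 5)%N ltn_add2l ltn_ord.
exists (Ordinal lt) => l.
have -> : (l == i) = (16 + i == 16 + l)%N by rewrite eqn_add2l eq_sym.
by rewrite mxE /coordz [X in (X < 16)%N]/= ltnNge leq_addr.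
Qed.

Theorem rp4_nice : exists h : 'rV[R]_21 -> RP R 4,
  nice_equilibrium_triangulation (signed_complex rp4_eps) h /\
  #|vertices (signed_complex rp4_eps)| = 21.
Proof.
have [h hL] := lifts_to_ex rp4_signed_fan; exists h; split.
  exact: (nice_signed_complex rp4_signed_fan rp4_card pos_le1 in_pyramid rp4_vertices
    pos_cases cube_vertex centre_vertex hL).
by rewrite (vertices_signed_complex rp4_vertices) cardsT card_ord.
Qed.

End FiveCube.

Local Close Scope ring_scope.

Theorem theorem4p8 (R : realType) :
  exists (N : nat) (K : {set {set 'I_N}}) (h : 'rV[R]_N -> RP R 4),
    nice_equilibrium_triangulation K h /\ #|vertices K| = 21.
Proof.
have [h hP] := rp4_nice R rp4_data_ok.
by exists 21, (signed_complex (@rp4_eps R rp4_facets)), h.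
Qed.
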